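(* Let $\mathbf{k}$ be a field of characteristic zero, $n\ge4$, and $S=(a_1,\dots,a_n)$ with positive integer entries such that $\mathrm{cotype}(S)=0$. Let $B_S=\mathbf{k}[X_1,\dots,X_n]/\langle X_1^{a_1}+\cdots+X_n^{a_n}\rangle$ with its standard $\mathbb{N}$-grading. Then: (a) $\mathbb{Z}(\ker D)=\mathbb{Z}$ for all $D\in\mathrm{HLND}(B_S)$. (b) If $B_S$ is not rigid, then the projective $\mathbf{k}$-variety $\mathrm{Proj}\,B_S$ is ruled over $\mathbf{k}$ (i.e. its function field is ruled over $\mathbf{k}$).
   Context: Write $x_i$ for the image of $X_i$ in $B_S$ and $L=\mathrm{lcm}(S)$; the standard $\mathbb{N}$-grading of $B_S$ is the unique one in which $x_i$ is homogeneous of degree $L/a_i$. $\mathrm{cotype}(S)$ is the number of indices $i$ with $a_i\nmid\mathrm{lcm}(a_1,\dots,\widehat{a_i},\dots,a_n)$. A derivation is locally nilpotent if every element is killed by some power of it, and homogeneous if it shifts degrees by a fixed amount; $\mathrm{HLND}(B_S)$ is the set of homogeneous locally nilpotent derivations. For a graded subring $A$, $\mathbb{Z}(A)$ is the subgroup of $\mathbb{Z}$ generated by the degrees $i$ with $A\cap (B_S)_i\neq 0$. $B_S$ is rigid if its only locally nilpotent derivation is $0$. A field extension $L/\mathbf{k}$ is ruled if $L=K^{(1)}$ (purely transcendental of transcendence degree 1) for some field $K$ with $\mathbf{k}\subseteq K\subseteq L$; a variety is ruled if its function field is ruled over $\mathbf{k}$. *)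

(* Defs.v *)
From HB Require Import structures.
From mathcomp Require Import all_boot all_order all_algebra.
From mathcomp Require Import fraction.
From mathcomp Require Export mpoly.
Set Implicit Arguments. Unset Strict Implicit. Unset Printing Implicit Defensive.
Import Order.TTheory GRing.Theory Num.Theory.
Local Open Scope ring_scope.

Section BS.
Variables (k : fieldType) (n : nat) (a : 'I_n -> nat).

Definition lcmS : nat := \big[lcmn/1%N]_(i < n) a i.

Definition cotype : nat :=
  #|[set i : 'I_n | ~~ (a i %| \big[lcmn/1%N]_(j < n | j != i) a j)%N]|.

Definition wt (i : 'I_n) : nat := lcmS %/ a i.

Definition wdeg (m : 'X_{1..n}) : nat := (\sum_(i < n) wt i * m i)%N.

Definition fS : {mpoly k[n]} := \sum_(i < n) 'X_i ^+ a i.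

(* congruence modulo the ideal <fS>: equality in B_S of the classes *)
Definition eqB (p q : {mpoly k[n]}) : Prop := exists r, p - q = r * fS.

(* the class of p in B_S is homogeneous of degree d (d : int; the only
   element of negative degree is 0) *)
Definition homB (d : int) (p : {mpoly k[n]}) : Prop :=
  exists q, eqB p q /\ forall m, m \in msupp q -> (wdeg m)%:Z = d.

(* a k-derivation of B_S, given on representatives *)
Definition derivB (D : {mpoly k[n]} -> {mpoly k[n]}) : Prop :=
  [/\ forall p q, eqB p q -> eqB (D p) (D q),
      forall p q, eqB (D (p + q)) (D p + D q),
      forall (c : k) p, eqB (D (c *: p)) (c *: D p)
    & forall p q, eqB (D (p * q)) (p * D q + q * D p)].

Definition locnilB (D : {mpoly k[n]} -> {mpoly k[n]}) : Prop :=
  forall p, exists m : nat, eqB (iter m D p) 0.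

Definition homogDB (D : {mpoly k[n]} -> {mpoly k[n]}) : Prop :=
  exists e : int, forall (d : int) p, homB d p -> homB (d + e) (D p).

Definition HLND (D : {mpoly k[n]} -> {mpoly k[n]}) : Prop :=
  [/\ derivB D, locnilB D & homogDB D].

Definition LND (D : {mpoly k[n]} -> {mpoly k[n]}) : Prop :=
  derivB D /\ locnilB D.

Definition rigidB : Prop :=
  forall D, LND D -> forall p, eqB (D p) 0.

Definition kerdeg (D : {mpoly k[n]} -> {mpoly k[n]}) (i : int) : Prop :=
  exists p, [/\ homB i p, ~ eqB p 0 & eqB (D p) 0].

End BS.

Definition Zgen (T : int -> Prop) (z : int) : Prop :=
  exists s : seq (int * int), (forall x, x \in s -> T x.2) /\
                              z = \sum_(x <- s) (x.1 * x.2).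

Section FunField.
Variables (k : fieldType) (n : nat) (a : 'I_n -> nat).

(* representatives a/b of elements of the function field of Proj B_S:
   a, b homogeneous of the same degree, b nonzero in B_S *)
Definition fracB (p q : {mpoly k[n]}) : Prop :=
  exists d : nat, [/\ homB a d p, homB a d q & ~ eqB a q 0].

(* the function field of Proj B_S is ruled over k: it is k-isomorphic to
   K(t) = Frac(K[t]) for some field K containing k.  The isomorphism is
   given on representatives (p, q) of p/q. *)
Definition ProjB_ruled : Prop :=
  exists (K : fieldType) (iota : {rmorphism k -> K})
         (Phi : {mpoly k[n]} -> {mpoly k[n]} -> {fraction {poly K}}),
  [/\ forall p q p' q', fracB p q -> fracB p' q' ->
         (eqB a (p * q') (p' * q) <-> Phi p q = Phi p' q'),
      forall z, exists p q, fracB p q /\ Phi p q = z,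
      forall p q p' q', fracB p q -> fracB p' q' ->
         Phi (p * q' + p' * q) (q * q') = Phi p q + Phi p' q',
      forall p q p' q', fracB p q -> fracB p' q' ->
         Phi (p * p') (q * q') = Phi p q * Phi p' q'
    & forall c : k, Phi c%:MP 1 = FracField.tofrac (iota c)%:P].

End FunField.

(* Main.v *)
Require Import Defs.
From HB Require Import structures.
From mathcomp Require Import all_boot all_order all_algebra all_field.
From mathcomp Require Import fraction generic_quotient.
From mathcomp Require Import mpoly.
From mathcomp Require Import ring.
From Stdlib Require Import Classical ClassicalEpsilon.
Set Implicit Arguments. Unset Strict Implicit. Unset Printing Implicit Defensive.
Import Order.TTheory GRing.Theory Num.Theory.
Local Open Scope ring_scope.

(* Let D be a nonzero homogeneous locally nilpotent derivation with kernel A, s a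
   homogeneous slice and f = D s <> 0 in A. Every homogeneous b satisfies
   f^E b = p(s) with p over A homogeneous, and the constant term of p has degree
   deg b + E deg f. Hence if deg b is not in Z(A) that term vanishes and s divides f^E b.
   Cotype 0 says that any n - 1 of the weights L/a_i generate Z, so if Z(A) <> Z then two
   weights are missed; the corresponding x_i, x_j form a regular sequence and s would
   divide a power of f, which is absurd.
   For the second part, the leading part of a nonzero locally nilpotent derivation is a
   nonzero homogeneous one. As Z(A) = Z, the slice can be rescaled by a quotient c of
   homogeneous elements of A so that t = s c has degree 0, and the function field of
   Proj B is K(t), with K the degree 0 part of the homogeneous localization of A.
   That B is a domain comes from the irreducibility of T^a + g over k(X_3, .., X_n)(x) for
   squarefree g in k(X_3, .., X_n)[x]. *)

(** * Irreducibility and the coordinate ring *)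

Lemma fraction_num_den (R : idomainType) (c : {fraction R}) :
  exists P Q : R, Q != 0 /\ c * FracField.tofrac Q = FracField.tofrac P.
Proof.
elim/quotW: c => x; exists (frac x).1, (frac x).2.
split; first exact: denom_ratioP.
unlock FracField.tofrac; rewrite -[LHS]FracField.pi_mul; apply/eqmodP.
rewrite /= FracField.equivfE /FracField.mulf !numden_Ratio ?mulr1 ?oner_eq0 ?denom_ratioP //.
by rewrite mulrC.
Qed.

Lemma fraction_coprimep (F : fieldType) (c : {fraction {poly F}}) :
  exists P Q : {poly F}, [/\ Q != 0, coprimep P Q &
    c * FracField.tofrac Q = FracField.tofrac P].
Proof.
have [P0 [Q0 [Q0n0 eP]]] := fraction_num_den c.
set g := gcdp P0 Q0.
have gn0 : g != 0 by rewrite gcdp_eq0 negb_and Q0n0 orbT.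
exists (P0 %/ g), (Q0 %/ g); split.
- by rewrite -(inj_eq (mulIf gn0)) mul0r divpK ?dvdp_gcdr.
- by apply: coprimep_div_gcd; rewrite Q0n0 orbT.
have gf : FracField.tofrac g != 0 by rewrite tofrac_eq0.
by apply: (mulIf gf); rewrite -mulrA -!tofracM !divpK ?dvdp_gcdl ?dvdp_gcdr.
Qed.

(* Differentiating P^a = u g^d gives a g P' = d g' P, so the squarefree g divides P,
   although a deg P = d deg g < a deg g. *)
Lemma expf_eq_squarefree_absurd (F : fieldType) (g P : {poly F}) (u : F) (a d : nat) :
  (forall m, m.+1%:R != 0 :> F) -> coprimep g g^`() -> (1 < size g)%N ->
  (0 < d < a)%N -> P ^+ a = u *: g ^+ d -> u != 0 -> False.
Proof.
move=> ch cop sg /andP[d0 da] E un0.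
have gn0 : g != 0 by rewrite -size_poly_gt0; case: size sg.
have a0 : (0 < a)%N by apply: leq_trans da.
have Pn0 : P != 0.
  apply/eqP => P0; move: E; rewrite P0 expr0n eqn0Ngt a0 /= => /esym/eqP.
  by rewrite scaler_eq0 (negPf un0) expf_eq0 (negPf gn0) andbF.
have E' : g * P^`() *+ a = g^`() * P *+ d.
  (* The factor [P * g] restores the full powers P^a and g^d after differentiation; they are equal
     up to u and cancel. *)
  have := congr1 (fun p => P * g * p^`()) E.
  rewrite derivZ !deriv_exp -[_ *+ a]mulr_natr -[_ *+ d]mulr_natr.
  have -> : P * g * (P^`() * P ^+ a.-1 * a%:R) = P ^+ a * (g * P^`() * a%:R).
    by rewrite -[in P ^+ a](prednK a0) [P ^+ _.+1]exprS; ring.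
  have -> : P * g * (u *: (g^`() * g ^+ d.-1 * d%:R)) = (u *: g ^+ d) * (g^`() * P * d%:R).
    by rewrite -[in g ^+ d](prednK d0) [g ^+ _.+1]exprS -!mul_polyC; ring.
  rewrite E => H.
  have nz : u *: g ^+ d != 0 by rewrite scaler_eq0 negb_or un0 expf_neq0.
  by apply: (mulfI nz); rewrite -[g * _ *+ a]mulr_natr -[_ * P *+ d]mulr_natr.
have gP : g %| P.
  have : g %| g^`() * P *+ d by rewrite -E' -mulr_natr -mulrA dvdp_mulIl.
  rewrite -mulr_natr -[d](prednK d0) -polyC_natr mulrC mul_polyC dvdpZr ?ch //.
  by rewrite Gauss_dvdpr.
have := dvdp_leq Pn0 gP.
have := congr1 (fun p : {poly F} => (size p).-1) E; rewrite size_scale // !size_exp.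
move: Pn0 gn0; rewrite -!size_poly_gt0; case: (size P) (size g) sg => [//|p] [//|q] /=.
rewrite !ltnS => q0 _ _ h1 h2.
have : (q * d < p * a)%N.
  by apply: leq_ltn_trans (_ : p * d < _)%N; rewrite ?leq_mul2r ?h2 ?orbT // ltn_mul2l da (leq_trans q0 h2).
by rewrite h1 ltnn.
Qed.

(** By Cayley-Hamilton the companion matrix of q is annihilated by q, hence by its multiple p. Its
    size is deg q, written as a successor so that matrices form a ring. *)
Lemma horner_mx_companion (F : fieldType) (q p : {poly F}) :
  q \is monic -> q %| p -> (1 < size q)%N ->
  exists (n : nat) (C : 'M[F]_n.+1), n.+2 = size q /\ horner_mx C p = 0.
Proof.
move=> mq qp sq; have e : (size q).-1 = (size q).-2.+1 by case: size sq => [|[]].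
have := companionmxK mq; move: (companionmx q); rewrite e => C hC.
exists (size q).-2, C; split; first by case: size sq => [|[]].
have /dvdpP [r ->] := qp.
have hq : horner_mx C q = 0 by rewrite -[X in horner_mx C X]hC Cayley_Hamilton.
by rewrite rmorphM /= hq mulr0.
Qed.

(* The companion matrix C of a factor of degree d < a satisfies C^a = -g, whence
   det(C)^a = (-g)^d; being integral over F[x], det C is a polynomial. *)
Lemma irreducible_XnaddC (F : fieldType) (g : {poly F}) (a : nat) :
  (forall m, m.+1%:R != 0 :> F) -> coprimep g g^`() -> (1 < size g)%N ->
  (0 < a)%N ->
  irreducible_poly ('X^a + (FracField.tofrac g)%:P : {poly {fraction {poly F}}}).
Proof.
move=> ch cop sg a0; set p := (X in irreducible_poly X).
have sp : size p = a.+1 by rewrite size_polyDl ?size_polyXn // size_polyC; case: eqP.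
have pn0 : p != 0 by rewrite -size_poly_gt0 sp.
split=> [|q sq qp]; first by rewrite sp.
have qn0 : q != 0 by apply: contraNneq pn0 => q0; rewrite q0 dvd0p in qp.
rewrite -dvdp_size_eqp // eqn_leq dvdp_leq //= sp.
have lq0 : lead_coef q != 0 by rewrite lead_coef_eq0.
pose q1 := (lead_coef q)^-1 *: q.
have sq1 : size q1 = size q by apply: size_scale; apply: invr_neq0.
have mq : q1 \is monic by rewrite monicE lead_coefZ mulVf.
have q1p : q1 %| p by rewrite dvdpZl ?invr_neq0.
have sq2 : (1 < size q1)%N.
  by move: qn0 sq; rewrite sq1 -size_poly_gt0; case: size => [|[]].
have [n [C [en hC]]] := horner_mx_companion mq q1p sq2.
rewrite -sq1 -en ltnS leqNgt; apply/negP => lt.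
have {hC}hC : C ^+ a = (- FracField.tofrac g)%:M.
  move: hC; rewrite rmorphD rmorphXn /= horner_mx_X horner_mx_C => /eqP.
  by rewrite addr_eq0 -raddfN => /eqP.
have : (\det C) ^+ a = (- FracField.tofrac g) ^+ n.+1.
  rewrite -[RHS]det_scalar -hC {hC}; clear; elim: a => [|m IH]; first by rewrite !expr0 det1.
  by rewrite !exprS -[in RHS]mulmxE det_mulmx IH.
have [P [Q [Qn0 cPQ eP]]] := fraction_coprimep (\det C).
move=> /(congr1 (fun z => z * (FracField.tofrac Q) ^+ a)).
rewrite -exprMn eP -rmorphN -!rmorphXn -rmorphM /= => /eqP; rewrite tofrac_eq => /eqP E.
(* Q^a divides P^a and is coprime to it, so the denominator is constant. *)
have uQ : size Q == 1%N.
  rewrite -coprimepp.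
  have : coprimep (P ^+ a) (Q ^+ a) by apply/coprimep_expl/coprimep_expr.
  rewrite E coprimep_sym coprimepMr => /andP[_].
  by rewrite coprimep_pexpl // coprimep_pexpr.
have /size_poly1P [u un0 eQ] := uQ.
apply: (@expf_eq_squarefree_absurd _ g P ((-1) ^+ n.+1 * u ^+ a) a n.+1) => //.
- by rewrite E eQ [(- g) ^+ _]exprNn -mul_polyC polyCM !polyC_exp polyCN; ring.
by rewrite mulf_neq0 // expf_neq0 // oppr_eq0 oner_eq0.
Qed.

Lemma rmorph_mpoly_ext (k : comNzRingType) (n : nat) (S : nzRingType)
    (g h : {rmorphism {mpoly k[n]} -> S}) :
  (forall c, g c%:MP = h c%:MP) -> (forall i, g 'X_i = h 'X_i) -> g =1 h.
Proof.
move=> eC eX p; rewrite [p]mpolyE !rmorph_sum; apply: eq_bigr => m _.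
rewrite -mul_mpolyC !rmorphM eC mpolyXE_id !rmorph_prod; congr (_ * _).
by apply: eq_bigr => i _; rewrite !rmorphXn eX.
Qed.

Lemma irreducible_coprime_or_dvd (F : fieldType) (p q : {poly F}) :
  irreducible_poly p -> p %| q \/ coprimep p q.
Proof.
move=> [p1 ip]; have [c|nc] := boolP (coprimep p q); first by right.
left; have /(ip _ nc) : gcdp p q %| p := dvdp_gcdl p q.
by move=> /eqp_dvdl <-; apply: dvdp_gcdr.
Qed.

(** The field is F with a root z of p adjoined, and h evaluates at z. A polynomial that vanishes at
    z without being divisible by p is coprime to p, and a Bezout relation evaluated at z reads 0 =
    1. *)
Lemma irreducible_poly_residue_field (F : fieldType) (p : {poly F}) :
  irreducible_poly p ->
  exists (M : fieldType) (h : {rmorphism {poly F} -> M}),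
    forall q, h q = 0 <-> p %| q.
Proof.
move=> ip; have [L _ [z rz _]] := irredp_FAdjoin ip.
have cz : commr_rmorph (in_alg L) z by move=> x; apply: mulrC.
exists L, (horner_morph cz) => q; split; last first.
  by move=> /dvdpP[r ->]; rewrite rmorphM /= [X in _ * X](rootP rz) mulr0.
move=> hq; have [//|/coprimepP] := irreducible_coprime_or_dvd q ip.
move=> cop; have /Bezout_eq1_coprimepP [[u v] /= e] : coprimep p q by apply/coprimepP.
have := congr1 (horner_morph cz) e.
rewrite rmorphD !rmorphM hq mulr0 addr0 rmorph1 [X in _ * X](rootP rz) mulr0 => /esym/eqP.
by rewrite oner_eq0.
Qed.

(** * Two distinguished variables *)

Section Embed.
Variables (k : fieldType) (n : nat) (i0 i1 : 'I_n).
Local Notation R := {mpoly k[n]}.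

(* k[X] is viewed inside k[X][x][T] through X_i0 |-> T and X_i1 |-> x; evaluating back
   at T = X_i0 and x = X_i1 is a retraction. *)
Definition two_var (i : 'I_n) : {poly {poly R}} :=
  if i == i0 then 'X else if i == i1 then 'X%:P else ('X_i)%:P%:P.

Definition expand : R -> {poly {poly R}} :=
  mmap (polyC \o (polyC \o @mpolyC n k)) two_var.
HB.instance Definition _ := GRing.RMorphism.on expand.

Definition collapse : {poly {poly R}} -> R :=
  horner_eval ('X_i1 : R) \o horner_eval (('X_i0)%:P : {poly R}).
HB.instance Definition _ := GRing.RMorphism.on collapse.

Lemma expandK : cancel expand collapse.
Proof.
apply: (@rmorph_mpoly_ext k n R (collapse \o expand) idfun) => [c|i] /=.
  by rewrite /expand mmapC /collapse /= /horner_eval !hornerE.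
rewrite /expand mmapX mmap1U /two_var /collapse /= /horner_eval.
case: eqP => [->|_]; first by rewrite !hornerE.
by case: eqP => [->|_]; rewrite !hornerE.
Qed.

End Embed.

Lemma pchar0_natr_neq0 (F : idomainType) :
  [pchar F] =i pred0 -> forall m, m.+1%:R != 0 :> F.
Proof.
move=> /pcharf0P ch m; by rewrite ch.
Qed.

Lemma squarefree_XnaddC (F : fieldType) (h : F) (b : nat) :
  (forall m, m.+1%:R != 0 :> F) -> (0 < b)%N -> h != 0 ->
  coprimep ('X^b + h%:P) ('X^b + h%:P)^`().
Proof.
move=> ch b0 hn0; apply/Bezout_coprimepP.
(* Euler's relation: b (X^b + h) - X (X^b + h)' = b h is a nonzero constant. *)
exists (b%:R%:P, - 'X) => /=.
have -> : b%:R%:P * ('X^b + h%:P) + - 'X * ('X^b + h%:P)^`() = (b%:R * h)%:P.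
  rewrite derivD derivXn derivC addr0 -{2}(prednK b0) exprS polyCM polyC_natr.
  by rewrite -mulr_natr; ring.
rewrite -(mulr1 (_%:P)) mul_polyC eqp_scale // mulf_neq0 //.
by rewrite -(prednK b0) ch.
Qed.

(** * Primality of the ideal of [fS] *)

Section Prime.
Variables (k : fieldType) (n : nat) (a : 'I_n -> nat) (i0 i1 : 'I_n).
Local Notation R := {mpoly k[n]}.

Definition other_terms (P : pred 'I_n) : R := \sum_(i | P i) 'X_i ^+ a i.

Lemma other_terms_neq0 (P : pred 'I_n) (i2 : 'I_n) :
  (forall i, 0 < a i)%N -> P i2 -> other_terms P != 0.
Proof.
move=> a0 Pi2; apply/eqP => /(congr1 (meval (fun i => (i == i2)%:R))).
rewrite meval0 raddf_sum /= (bigD1 i2) //= big1 => [|i /andP[_ ni]].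
  by rewrite rmorphXn /= mevalXU eqxx expr1n addr0 => /eqP; rewrite oner_eq0.
by rewrite rmorphXn /= mevalXU (negPf ni) expr0n eqn0Ngt a0.
Qed.

Lemma expand_fS : i0 != i1 ->
  expand i0 i1 (fS k a) =
    'X^(a i0) + ('X^(a i1) + (other_terms [pred i | (i != i0) && (i != i1)])%:P)%:P.
Proof.
move=> i01; have i10 : i1 != i0 by rewrite eq_sym.
rewrite /fS (bigD1 i0) //= (bigD1 i1) //= !rmorphD !rmorphXn /=.
have eX i : expand i0 i1 ('X_i : R) = two_var k i0 i1 i.
  by rewrite /expand mmapX mmap1U.
rewrite !eX /two_var (negPf i10) !eqxx; congr (_ + (_ + _)).
rewrite /other_terms !rmorph_sum; apply: eq_bigr => i /andP[ni0 ni1].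
by rewrite !rmorphXn /= eX /two_var (negPf ni0) (negPf ni1).
Qed.

Lemma expand_fS_monic : i0 != i1 -> (0 < a i0)%N -> expand i0 i1 (fS k a) \is monic.
Proof.
move=> i01 a0; rewrite expand_fS // monicE lead_coefDl ?lead_coefXn //.
by rewrite size_polyXn (leq_ltn_trans (size_polyC_leq1 _)).
Qed.

Variables (K : fieldType) (j : {rmorphism {poly R} -> K}).
Hypothesis inj_j : injective j.

(** Divisibility descends from K[T] because [fS] is monic in T: the division can be done over
    k[X][x], its remainder vanishes for degree reasons, and [collapse] brings the quotient back to
    k[X]. *)
Lemma map_expand_dvdp (p : R) : i0 != i1 -> (0 < a i0)%N ->
  map_poly j (expand i0 i1 (fS k a)) %| map_poly j (expand i0 i1 p) <-> eqB a p 0.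
Proof.
move=> i01 a0; split; last first.
  move=> [r]; rewrite subr0 => ->; rewrite (rmorphM (expand i0 i1)) rmorphM.
  exact: dvdp_mulIr.
move=> dv; have mf := expand_fS_monic i01 a0.
have := Pdiv.RingMonic.rdivp_eq mf (expand i0 i1 p).
set q := Pdiv.Ring.rdivp _ _; set r := Pdiv.Ring.rmodp _ _ => e.
have sr : (size r < size (expand i0 i1 (fS k a)))%N.
  exact: Pdiv.Ring.ltn_rmodpN0 (monic_neq0 mf).
have szj (u : {poly {poly R}}) : size (map_poly j u) = size u.
  by apply: size_map_inj_poly; rewrite ?rmorph0.
have r0 : r = 0.
  apply/eqP; apply: contraTT sr => nr.
  rewrite -leqNgt -!szj dvdp_leq //.
    by rewrite -size_poly_gt0 szj size_poly_gt0.
  have -> : map_poly j r = map_poly j (expand i0 i1 p)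
      - map_poly j q * map_poly j (expand i0 i1 (fS k a)).
    by rewrite [in RHS]e rmorphD rmorphM addrAC subrr add0r.
  by apply: dvdp_sub; [exact: dv | exact/dvdp_mull/dvdpp].
exists (collapse i0 i1 q); rewrite subr0.
have := congr1 (collapse i0 i1) e; rewrite r0 addr0.
rewrite (expandK i0 i1 p).
by rewrite (rmorphM (collapse i0 i1)) => ->; congr (_ * _); apply: expandK.
Qed.

Lemma residue_field_of_irreducible : i0 != i1 -> (0 < a i0)%N ->
  irreducible_poly (map_poly j (expand i0 i1 (fS k a))) ->
  exists (M : fieldType) (h : {rmorphism R -> M}), forall p, h p = 0 <-> eqB a p 0.
Proof.
move=> i01 a0 irr; have [M [h hM]] := irreducible_poly_residue_field irr.
exists M, (h \o (map_poly j \o expand i0 i1)) => p.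
have e := map_expand_dvdp p i01 a0.
have e2 := hM (map_poly j (expand i0 i1 p)).
split=> [H|/(proj2 e)/(proj2 e2)//].
apply/(proj1 e)/(proj1 e2); exact: H.
Qed.

End Prime.

(** The morphism identifies B_S with a subring of a field. A third variable makes the constant term
    of g = x^b + [ot] nonzero, so that g is squarefree in x. *)
Theorem fS_residue_field (k : fieldType) (n : nat) (a : 'I_n -> nat) :
  (forall m, m.+1%:R != 0 :> k) -> (3 <= n)%N -> (forall i, 0 < a i)%N ->
  exists (M : fieldType) (h : {rmorphism {mpoly k[n]} -> M}),
    forall p, h p = 0 <-> eqB a p 0.
Proof.
move=> ch n3 a0.
pose i0 := Ordinal (ltn_trans (isT : 0 < 2)%N n3).
pose i1 := Ordinal (ltn_trans (isT : 1 < 2)%N n3).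
pose i2 := Ordinal n3.
have i01 : i0 != i1 by [].
have chR : forall m, m.+1%:R != 0 :> {mpoly k[n]}.
  by move=> m; rewrite -(rmorph_nat (@mpolyC n k)) mpolyC_eq0.
have chF : forall m, m.+1%:R != 0 :> {fraction {mpoly k[n]}}.
  by move=> m; rewrite -(rmorph_nat (@FracField.tofrac _)) tofrac_eq0.
(* The coefficients are embedded in F(x), with F the fraction field of k[X], where the criterion for
   T^a + g with g in F[x] applies. *)
pose j : {rmorphism {poly {mpoly k[n]}} -> _} :=
  @FracField.tofrac {poly {fraction {mpoly k[n]}}} \o map_poly (@FracField.tofrac {mpoly k[n]}).
apply: (@residue_field_of_irreducible k n a i0 i1 _ j) => //.
  move=> x y /eqP; rewrite /j /= tofrac_eq => /eqP.
  apply: map_inj_poly; last by rewrite tofrac0.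
  by move=> u v /eqP; rewrite tofrac_eq => /eqP.
set ot := other_terms k a [pred i | (i != i0) && (i != i1)].
have -> : map_poly j (expand i0 i1 (fS k a)) =
    'X^(a i0) + (FracField.tofrac ('X^(a i1) + (FracField.tofrac ot)%:P))%:P.
  rewrite expand_fS // rmorphD /= map_polyXn map_polyC /=.
  by rewrite rmorphD /= map_polyXn map_polyC.
apply: irreducible_XnaddC => //.
  apply: squarefree_XnaddC => //.
  by rewrite tofrac_eq0; apply: (other_terms_neq0 _ (i2 := i2)).
rewrite size_polyDl size_polyXn ?ltnS //.
exact: leq_trans (size_polyC_leq1 _) _.
Qed.

(** * Images and subfields as types *)

Definition asbool (P : Prop) : bool := if excluded_middle_informative P then true else false.

Lemma asboolP (P : Prop) : reflect P (asbool P).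
Proof. by rewrite /asbool; case: excluded_middle_informative => h; constructor. Qed.

Section Image.
Variables (R : comNzRingType) (M : fieldType) (phi : {rmorphism R -> M}).

Definition in_image : {pred M} := fun x => asbool (exists p, phi p = x).

Lemma in_imageP x : reflect (exists p, phi p = x) (x \in in_image).
Proof. exact: asboolP. Qed.

Fact in_image_subring : subring_closed in_image.
Proof.
split=> [|_ _ /in_imageP[p <-] /in_imageP[q <-]|_ _ /in_imageP[p <-] /in_imageP[q <-]].
- by apply/in_imageP; exists 1; rewrite rmorph1.
- by apply/in_imageP; exists (p - q); rewrite rmorphB.
by apply/in_imageP; exists (p * q); rewrite rmorphM.
Qed.
HB.instance Definition _ := GRing.isSubringClosed.Build M in_image in_image_subring.

Inductive image_ring := ImageElt x & x \in in_image.
Definition image_val u := let: ImageElt x _ := u in x.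
HB.instance Definition _ := [isSub for image_val].
HB.instance Definition _ := [Choice of image_ring by <:].
HB.instance Definition _ := [SubChoice_isSubComNzRing of image_ring by <:].

(** An [idomainType] carries a unit predicate and a total inverse. Both are obtained classically,
    and the inverse is the identity on non-units as the interface demands. *)
Definition image_unit : {pred image_ring} := fun u => asbool (exists v, v * u = 1).
Definition image_inv (u : image_ring) : image_ring :=
  if excluded_middle_informative (exists v, v * u = 1) is left h
  then proj1_sig (constructive_indefinite_description _ h) else u.

Fact image_mulVr : {in image_unit, left_inverse 1 image_inv *%R}.
Proof.
move=> u /asboolP ex; rewrite /image_inv; case: excluded_middle_informative => // h.
by case: constructive_indefinite_description.
Qed.
Fact image_unitPl (x y : image_ring) : y * x = 1 -> x \in image_unit.
Proof. by move=> e; apply/asboolP; exists y. Qed.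
Fact image_inv_out : {in [predC image_unit], image_inv =1 id}.
Proof.
move=> u; rewrite inE => /asboolP n; rewrite /image_inv.
by case: excluded_middle_informative.
Qed.
HB.instance Definition _ := GRing.ComNzRing_hasMulInverse.Build image_ring
  image_mulVr image_unitPl image_inv_out.

Fact image_integral (x y : image_ring) : x * y = 0 -> (x == 0) || (y == 0).
Proof.
move=> /(congr1 val) /eqP; rewrite rmorphM rmorph0 mulf_eq0.
by rewrite -!(rmorph0 (val : image_ring -> M)) !(inj_eq val_inj).
Qed.
HB.instance Definition _ := GRing.ComUnitRing_isIntegral.Build image_ring image_integral.

Fact in_imageT p : phi p \in in_image.
Proof. by apply/in_imageP; exists p. Qed.
Definition to_image p : image_ring := ImageElt (in_imageT p).
Fact to_image_zmod : zmod_morphism to_image.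
Proof. by move=> x y; apply: val_inj; rewrite /= !rmorphB. Qed.
Fact to_image_monoid : monoid_morphism to_image.
Proof. by split=> [|x y]; apply: val_inj; rewrite /= ?rmorph1 ?rmorphM. Qed.
HB.instance Definition _ := GRing.isZmodMorphism.Build R image_ring to_image to_image_zmod.
HB.instance Definition _ := GRing.isMonoidMorphism.Build R image_ring to_image to_image_monoid.

(** Applied to the morphism of [fS_residue_field], this gives B_S as a domain with its quotient
    map. *)
Lemma image_idomain : exists (B : idomainType) (pi : {rmorphism R -> B}),
  (forall p, pi p = 0 <-> phi p = 0) /\ (forall b, exists p, pi p = b).
Proof.
exists image_ring, to_image; split=> [p|b].
  split=> [/(congr1 val)/= -> //|e].
  by apply: val_inj; rewrite /= e.
by case: b => x hx; have /in_imageP[p ep] := hx; exists p; apply: val_inj.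
Qed.
End Image.

Section Subfield.
Variables (M : fieldType) (S : M -> Prop).
Hypothesis (S1 : S 1) (SB : forall x y, S x -> S y -> S (x - y))
  (SD : forall x y, S x -> S y -> S (x / y)).

Definition in_subfield : {pred M} := fun x => asbool (S x).
Fact in_subfield_divring : divring_closed in_subfield.
Proof.
by split=> [|x y /asboolP Sx /asboolP Sy|x y /asboolP Sx /asboolP Sy];
   apply/asboolP; [|apply: SB|apply: SD].
Qed.
HB.instance Definition _ := GRing.isDivringClosed.Build M in_subfield in_subfield_divring.

Inductive subfield := SubfieldElt x & x \in in_subfield.
Definition subfield_val u := let: SubfieldElt x _ := u in x.
HB.instance Definition _ := [isSub for subfield_val].
HB.instance Definition _ := [Choice of subfield by <:].
HB.instance Definition _ := [SubChoice_isSubComUnitRing of subfield by <:].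
HB.instance Definition _ := [SubComUnitRing_isSubIntegralDomain of subfield by <:].
HB.instance Definition _ := [SubIntegralDomain_isSubField of subfield by <:].

Variables (k : nzRingType) (h : {rmorphism k -> M}).
Hypothesis Sh : forall c, S (h c).
Fact in_subfieldT c : h c \in in_subfield.
Proof. exact/asboolP. Qed.
Definition to_subfield c : subfield := SubfieldElt (in_subfieldT c).
Fact to_subfield_zmod : zmod_morphism to_subfield.
Proof. by move=> x y; apply: val_inj; rewrite /= !rmorphB. Qed.
Fact to_subfield_monoid : monoid_morphism to_subfield.
Proof. by split=> [|x y]; apply: val_inj; rewrite /= ?rmorph1 ?rmorphM. Qed.
HB.instance Definition _ := GRing.isZmodMorphism.Build k subfield to_subfield to_subfield_zmod.
HB.instance Definition _ := GRing.isMonoidMorphism.Build k subfield to_subfield to_subfield_monoid.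

(** This will produce the base field K of the ruling, from the degree 0 part of the localized
    kernel. *)
Lemma subfield_ex : exists (K : fieldType) (j : {rmorphism K -> M}) (i : {rmorphism k -> K}),
  (forall c, j (i c) = h c) /\ (forall x, S x <-> exists y, j y = x).
Proof.
exists subfield, (\val : subfield -> M), to_subfield; split=> // x.
split=> [Sx|[[y Sy] <-]]; last exact/asboolP.
have /asboolP {}Sx := Sx.
by exists (SubfieldElt Sx).
Qed.
End Subfield.

(** * Homogeneous locally nilpotent derivations *)

(** [H d x] reads: x is homogeneous of degree d, zero having every degree. Inverses of positive
    integers sit in degree 0, so that integrating a polynomial respects degrees. *)
Record graded (B : idomainType) (H : int -> B -> Prop) : Prop := Graded {
  graded_sub : forall d x y, H d x -> H d y -> H d (x - y);
  graded_mul : forall d e x y, H d x -> H e y -> H (d + e) (x * y);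
  graded_one : H 0 1;
  graded_natV : forall m, H 0 (m.+1%:R^-1);
  graded_zero : forall d, H d 0 }.

Section GradedTheory.
Variables (B : idomainType) (H : int -> B -> Prop).
Hypothesis grH : graded H.

Lemma graded_add d x y : H d x -> H d y -> H d (x + y).
Proof.
move=> Hx Hy; rewrite -[y]opprK -[- y]sub0r; apply: (graded_sub grH) => //.
by apply: (graded_sub grH) => //; apply: graded_zero grH d.
Qed.

Lemma graded_exp d x m : H d x -> H (m%:Z * d) (x ^+ m).
Proof.
move=> Hx; elim: m => [|m IH]; first by rewrite mul0r expr0; apply: graded_one.
by rewrite exprS intS mulrDl mul1r; apply: (graded_mul grH).
Qed.

Lemma graded_sum d (I : finType) (F : I -> B) :
  (forall i, H d (F i)) -> H d (\sum_i F i).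
Proof. by move=> HF; elim/big_ind: _ => //; [apply: graded_zero grH d|apply: graded_add]. Qed.

End GradedTheory.

Lemma Zgen_base (T : int -> Prop) z : T z -> Zgen T z.
Proof.
move=> Tz; exists [:: (1, z)]; split; first by move=> x; rewrite inE => /eqP ->.
by rewrite big_seq1 mul1r.
Qed.

Lemma Zgen_lin (T : int -> Prop) (c d y z : int) :
  Zgen T y -> Zgen T z -> Zgen T (c * y + d * z).
Proof.
move=> [s [Ts ->]] [s' [Ts' ->]].
exists ([seq (c * x.1, x.2) | x <- s] ++ [seq (d * x.1, x.2) | x <- s']); split.
  by move=> x; rewrite mem_cat => /orP[] /mapP[u us ->] /=; [apply: Ts|apply: Ts'].
by rewrite big_cat !big_map !mulr_sumr; congr (_ + _); apply: eq_bigr => i _ /=; rewrite mulrA.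
Qed.

Section LND.
Variables (B : idomainType) (H : int -> B -> Prop).
Hypothesis grH : graded H.
Hypothesis chB : forall m, (m.+1%:R : B) \is a GRing.unit.
Variables (D : {additive B -> B}) (e : int).
Hypothesis DM : forall x y, D (x * y) = x * D y + y * D x.
Hypothesis Dnil : forall b, exists m, iter m D b = 0.
Hypothesis DH : forall d b, H d b -> H (d + e) (D b).

Lemma der1 : D 1 = 0.
Proof. by have := DM 1 1; rewrite !mul1r -[LHS]addr0 => /addrI. Qed.

Lemma der_nat m : D m%:R = 0.
Proof. by rewrite raddfMn der1 mul0rn. Qed.

Lemma ker_mul x y : D x = 0 -> D y = 0 -> D (x * y) = 0.
Proof. by rewrite DM => -> ->; rewrite !mulr0 addr0. Qed.

Lemma ker_exp x m : D x = 0 -> D (x ^+ m) = 0.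
Proof.
by move=> Dx; elim: m => [|m IH]; [rewrite expr0 der1|rewrite exprS ker_mul].
Qed.

Lemma der_kerM x y : D x = 0 -> D (x * y) = x * D y.
Proof. by rewrite DM => ->; rewrite mulr0 addr0. Qed.

Lemma der_natV m : D (m.+1%:R^-1) = 0.
Proof.
have : m.+1%:R * D (m.+1%:R^-1) = 0 by rewrite -(der_kerM _ (der_nat _)) divrr ?der1.
by move/(congr1 ( *%R m.+1%:R^-1)); rewrite mulr0 mulKr.
Qed.

Lemma iter_der0 m : iter m D 0 = 0.
Proof. by elim: m => //= m ->; rewrite raddf0. Qed.

Lemma natr_neq0 m : (m.+1%:R : B) != 0.
Proof. by apply: contraTneq (chB m) => ->; rewrite unitr0. Qed.

Definition ker_poly (p : {poly B}) := forall i, D p`_i = 0.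

Lemma der_horner (p : {poly B}) s : ker_poly p -> D p.[s] = p^`().[s] * D s.
Proof.
elim/poly_ind: p => [|p c IH] kp; first by rewrite horner0 raddf0 deriv0 horner0 mul0r.
have Dc : D c = 0 by have := kp 0; rewrite coefD coefMX coefC add0r.
have {}IH : D p.[s] = p^`().[s] * D s.
  by apply: IH => i; have := kp i.+1; rewrite coefD coefMX coefC addr0.
rewrite hornerMXaddC derivD derivC addr0 derivM derivX mulr1 !hornerE raddfD Dc addr0.
by rewrite DM IH; ring.
Qed.

Lemma deriv_eq0 (p : {poly B}) : p^`() = 0 -> p = (p`_0)%:P.
Proof.
move=> dp; apply/polyP => -[|i]; rewrite coefC //=.
apply/eqP; have /eqP := congr1 (fun q : {poly B} => q`_i) dp.
by rewrite coef_deriv coef0 -mulr_natr mulf_eq0 (negPf (natr_neq0 i)) orbF.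
Qed.

(** An element outside the kernel is transcendental over it: applying D to p(s) = 0 gives p'(s) D s
    = 0, so p' = 0 by induction on the size, and p is a constant with value 0. *)
Lemma ker_poly_horner_inj (p : {poly B}) s :
  D s != 0 -> ker_poly p -> p.[s] = 0 -> p = 0.
Proof.
move=> Ds; have [m] := ubnP (size p); elim: m p => // m IH p sp kp ps.
have [//|pn] := eqVneq p 0; suff dp : p^`() = 0.
  by move: ps; rewrite (deriv_eq0 dp) hornerC => ->.
apply: IH.
- by rewrite (leq_trans (lt_size_deriv pn)).
- by move=> i; rewrite coef_deriv raddfMn kp mul0rn.
have /eqP := der_horner s kp.
by rewrite ps raddf0 eq_sym mulf_eq0 (negPf Ds) orbF => /eqP.
Qed.

(* Integrating the expansion of [D b] along the slice leaves an element of the kernel. *)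
Lemma slice_expansion s ds : D (D s) = 0 -> H ds s ->
  forall m d b, iter m D b = 0 -> H d b ->
  exists (E : nat) (p : {poly B}),
    [/\ ker_poly p, forall i, H (d + E%:Z * (ds + e) - i%:Z * ds) p`_i
      & (D s) ^+ E * b = p.[s]].
Proof.
move=> Dfs Hs; have Hf := DH Hs; set f := D s in Dfs Hf *.
elim=> [|m IH] d b.
  move=> /= -> Hb; exists 0%N, 0; split=> [i|i|].
  - by rewrite coef0 raddf0.
  - by rewrite coef0; apply: graded_zero.
  by rewrite mulr0 horner0.
rewrite iterSr => nb Hb; have [E [p [kp Hp ep]]] := IH _ _ nb (DH Hb).
(* The antiderivative of p without constant term: at i = 0 the second factor is the inverse of 0,
   which is 0. *)
pose q := \poly_(i < (size p).+1) (p`_i.-1 * i%:R^-1).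
have q0 : q`_0 = 0 by rewrite coef_poly /= invr0 mulr0.
have qS i : q`_i.+1 = p`_i * i.+1%:R^-1.
  by rewrite coef_poly ltnS; case: ltnP => // /(nth_default 0) ->; rewrite mul0r.
have kq : ker_poly q.
  by case=> [|i]; [rewrite q0 raddf0|rewrite qS ker_mul ?der_natV].
have Hq i : H (d + E.+1%:Z * (ds + e) - i%:Z * ds) q`_i.
  case: i => [|i]; first by rewrite q0; apply: graded_zero.
  rewrite qS; have -> : d + E.+1%:Z * (ds + e) - i.+1%:Z * ds
     = (d + e + E%:Z * (ds + e) - i%:Z * ds) + 0 by rewrite !intS; ring.
  by apply: (graded_mul grH) (Hp i) (graded_natV grH i).
have dq : q^`() = p.
  apply/polyP => i; rewrite coef_deriv qS -[LHS]mulr_natr divrK //.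
(* D q(s) = p(s) f = f^(E+1) D b, so r is in the kernel and serves as the constant term. *)
pose r := f ^+ E.+1 * b - q.[s].
have Hr : H (d + E.+1%:Z * (ds + e)) r.
  apply: (graded_sub grH).
    by rewrite addrC; apply: (graded_mul grH) => //; apply: graded_exp.
  rewrite horner_coef; apply: (graded_sum grH) => i.
  have -> : d + E.+1%:Z * (ds + e) = (d + E.+1%:Z * (ds + e) - i%:Z * ds) + i%:Z * ds by ring.
  by apply: (graded_mul grH) => //; apply: graded_exp.
have kr : D r = 0.
  rewrite raddfB der_kerM ?ker_exp // der_horner // dq -ep -/f exprS.
  by ring.
exists E.+1, (q + r%:P); split=> [i|i|].
- by rewrite coefD coefC raddfD kq; case: ifP; rewrite ?kr ?raddf0 add0r.
- rewrite coefD coefC; apply: (graded_add grH) => //.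
  case: eqP => [->|_]; last exact: graded_zero.
  by rewrite mul0r subr0.
by rewrite hornerD hornerC /r addrC subrK.
Qed.

(** Only two terms of the Leibniz formula survive when D^2 s = 0. At m = 0 the second has
    coefficient 0, whatever [m.-1] means. *)
Lemma iter_der_slice s w m : D (D s) = 0 ->
  iter m D (s * w) = s * iter m D w + m%:R * D s * iter m.-1 D w.
Proof.
move=> Dfs; elim: m => [|m IH]; first by rewrite /= !mul0r addr0.
rewrite iterS IH raddfD !DM Dfs der_nat /=.
case: m {IH} => [|m] /=; first by rewrite !mul0r; ring.
by rewrite -[m.+2]addn1 natrD; ring.
Qed.

(** Let q + 1 be the least number of applications of D that kill w, and f = D s. Then D^(q+1) (s w)
    = (q+1) f D^q w is nonzero, whereas D kills f^N. *)
Lemma slice_ndvd s w N : D s != 0 -> D (D s) = 0 -> D s ^+ N = s * w -> False.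
Proof.
move=> fn0 Dfs eN.
have wn0 : w != 0.
  by have := expf_neq0 N fn0; rewrite eN mulf_eq0 negb_or => /andP[].
have ex : exists m, iter m D w == 0 by have [m /eqP] := Dnil w; exists m.
case: (ex_minnP ex) => -[/=|q]; first by rewrite (negPf wn0).
move=> /eqP hq hmin.
have := iter_der_slice w q.+1 Dfs; rewrite -eN iterSr (ker_exp _ Dfs) iter_der0 hq.
rewrite mulr0 add0r => /esym/eqP /=.
rewrite !mulf_eq0 (negPf (natr_neq0 q)) (negPf fn0) /= => /hmin.
by rewrite ltnn.
Qed.

(** The least power of D that kills b is at least 2; writing it m + 2, the slice is D^m b. *)
Lemma slice_ex d b : H d b -> D b != 0 ->
  exists ds s, [/\ H ds s, D s != 0 & D (D s) = 0].
Proof.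
move=> Hb Db.
have ex : exists m, iter m D b == 0 by have [m /eqP] := Dnil b; exists m.
case: (ex_minnP ex) => -[/=|[/=|m]].
- by move=> /eqP b0; move: Db; rewrite b0 raddf0 eqxx.
- by rewrite (negPf Db).
move=> /= /eqP h hmin.
have [d' Hd'] : exists d', H d' (iter m D b).
  elim: m {h hmin} => [|m [d' Hd']]; first by exists d.
  by exists (d' + e); apply: DH.
exists d', (iter m D b); split=> //.
by apply/negP => /(hmin m.+1); rewrite ltnn.
Qed.

Definition ker_degree (z : int) := exists b, [/\ H z b, b <> 0 & D b = 0].

Lemma slice_dvd s ds d x : D s != 0 -> D (D s) = 0 -> H ds s ->
  H d x -> ~ Zgen ker_degree d -> exists (E : nat) u, D s ^+ E * x = s * u.
Proof.
move=> fn0 Dfs Hs Hx nz; have [m hm] := Dnil x.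
have [E [p [kp Hp ep]]] := slice_expansion Dfs Hs hm Hx.
suff p0 : p`_0 = 0.
  exists E, (\poly_(i < size p) p`_i.+1).[s].
  have e1 : p = \poly_(i < size p) p`_i.+1 * 'X.
    apply/polyP => -[|i]; rewrite coefMX //= coef_poly.
    by case: ltnP => // h; rewrite nth_default // ltnW.
  by rewrite ep [in LHS]e1 hornerMX mulrC.
have [//|/eqP pn0] := eqVneq p`_0 0; case: nz.
have T1 : ker_degree (d + E%:Z * (ds + e)).
  by exists p`_0; split=> //; have := Hp 0; rewrite mul0r subr0.
have T2 : ker_degree (ds + e) by exists (D s); split=> //; [apply: DH|apply/eqP].
have -> : d = 1 * (d + E%:Z * (ds + e)) + (- E%:Z) * (ds + e) by ring.
by apply: Zgen_lin; apply: Zgen_base.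
Qed.

(* If both degrees were missed, x and y would vanish on the slice divisor s = 0,
   which would then have codimension two. *)
Lemma regular_pair_degree d d' x y b0 db :
  H db b0 -> D b0 != 0 -> H d x -> H d' y -> x != 0 ->
  (forall u v, x * v = y * u -> exists w, u = x * w) ->
  ~ Zgen ker_degree d -> ~ Zgen ker_degree d' -> False.
Proof.
move=> Hb0 Db0 Hx Hy xn0 reg nd nd'.
have [ds [s [Hs fn0 Dfs]]] := slice_ex Hb0 Db0.
have [E [u eu]] := slice_dvd fn0 Dfs Hs Hx nd.
have [E' [v ev]] := slice_dvd fn0 Dfs Hs Hy nd'.
have sn0 : s != 0 by apply: contraNneq fn0 => ->; rewrite raddf0.
(* Cancelling s in the two expressions of f^(E+E') x y gives x f^E v = y f^E' u, where f = D s;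
   regularity then applies. *)
have [w ew] : exists w, D s ^+ E' * u = x * w.
  apply: (reg _ (D s ^+ E * v)); apply: (mulfI sn0).
  have -> : s * (x * (D s ^+ E * v)) = D s ^+ E * x * (s * v) by ring.
  have -> : s * (y * (D s ^+ E' * u)) = D s ^+ E' * y * (s * u) by ring.
  by rewrite -eu -ev; ring.
(* Now x f^(E'+E) = f^E' s u = x s w, so s divides a power of f. *)
apply: (@slice_ndvd s w (E' + E)) => //; apply: (mulfI xn0).
have -> : x * (s * w) = s * (x * w) by ring.
by rewrite -ew exprD; transitivity (D s ^+ E' * (D s ^+ E * x)); [ring|rewrite eu; ring].
Qed.

End LND.

(** * The function field *)

(* [frac_val ev z x]: the extension of ev to fractions maps z to x. *)
Section FracVal.
Variables (A : idomainType) (M : fieldType) (ev : {rmorphism A -> M}).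
Hypothesis ev_inj : injective ev.

Definition frac_val (z : {fraction A}) (x : M) := exists P Q : A,
  [/\ Q != 0, z = FracField.tofrac P / FracField.tofrac Q & x = ev P / ev Q].

Lemma frac_val_eq P Q P' Q' : Q != 0 -> Q' != 0 ->
  FracField.tofrac P / FracField.tofrac Q = FracField.tofrac P' / FracField.tofrac Q' <->
  ev P / ev Q = ev P' / ev Q'.
Proof.
move=> Qn0 Q'n0.
have e1 : ev Q != 0 by rewrite (raddf_eq0 _ ev_inj).
have e2 : ev Q' != 0 by rewrite (raddf_eq0 _ ev_inj).
split=> /eqP; rewrite eqr_div ?tofrac_eq0 // -!rmorphM => /eqP.
  by move=> /eqP; rewrite tofrac_eq => /eqP h; apply/eqP; rewrite eqr_div // -!rmorphM h.
by move=> /ev_inj h; apply/eqP; rewrite eqr_div ?tofrac_eq0 // -!rmorphM h.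
Qed.

Lemma frac_val_fun z x x' : frac_val z x -> frac_val z x' -> x = x'.
Proof.
move=> [P [Q [Qn ez ->]]] [P' [Q' [Q'n ez' ->]]].
by apply/(frac_val_eq P P' Qn Q'n); rewrite -ez.
Qed.

Lemma frac_val_inj z z' x : frac_val z x -> frac_val z' x -> z = z'.
Proof.
move=> [P [Q [Qn -> ez]]] [P' [Q' [Q'n -> ez']]].
by apply/(frac_val_eq P P' Qn Q'n); rewrite -ez.
Qed.

Lemma frac_valD z z' x x' : frac_val z x -> frac_val z' x' -> frac_val (z + z') (x + x').
Proof.
move=> [P [Q [Qn -> ->]]] [P' [Q' [Q'n -> ->]]].
exists (P * Q' + P' * Q), (Q * Q'); split; first by rewrite mulf_neq0.
  by rewrite addf_div ?tofrac_eq0 // rmorphD !rmorphM.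
by rewrite addf_div ?(raddf_eq0 _ ev_inj) // rmorphD !rmorphM.
Qed.

Lemma frac_valM z z' x x' : frac_val z x -> frac_val z' x' -> frac_val (z * z') (x * x').
Proof.
move=> [P [Q [Qn -> ->]]] [P' [Q' [Q'n -> ->]]].
exists (P * P'), (Q * Q'); split; first by rewrite mulf_neq0.
  by rewrite mulf_div !rmorphM.
by rewrite mulf_div !rmorphM.
Qed.

Lemma frac_val_ex z : exists P Q, [/\ Q != 0, z = FracField.tofrac P / FracField.tofrac Q
  & frac_val z (ev P / ev Q)].
Proof.
have [P [Q [Qn e]]] := fraction_num_den z; exists P, Q.
have ez : z = FracField.tofrac P / FracField.tofrac Q by rewrite -e mulfK // tofrac_eq0.
by split=> //; exists P, Q.
Qed.

Lemma frac_val_tofrac P : frac_val (FracField.tofrac P) (ev P).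
Proof. by exists P, 1; rewrite oner_neq0 !rmorph1 !divr1. Qed.

End FracVal.

(** Used on the i-th term of a slice expansion, with u its coefficient, v = s^i and w = c^i, so that
    v w = t^i. *)
Lemma unscale_term (F : fieldType) (u v f x w : F) : f != 0 -> x != 0 -> w != 0 ->
  u * v = f * (x * (u / f / x * w^-1 * (v * w))).
Proof. by move=> fn xn wn; field; rewrite fn xn wn. Qed.

(** * The localized kernel and the coordinate t *)

Section Ruled.
Variables (B : idomainType) (H : int -> B -> Prop).
Hypothesis grH : graded H.
Hypothesis chB : forall m, (m.+1%:R : B) \is a GRing.unit.
Hypothesis Hpos : forall d b, H d b -> b <> 0 -> exists m : nat, d = m.
Variables (D : {additive B -> B}) (e : int).
Hypothesis DM : forall x y, D (x * y) = x * D y + y * D x.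
Hypothesis Dnil : forall b, exists m, iter m D b = 0.
Hypothesis DH : forall d b, H d b -> H (d + e) (D b).
Hypothesis Dfull : forall z, Zgen (ker_degree H D) z.
Variables (ds : int) (s : B).
Hypotheses (Hs : H ds s) (fn0 : D s != 0) (Dfs : D (D s) = 0).

Local Notation M := {fraction B}.
Local Notation j := (@FracField.tofrac B).

(* The degree d part of the localization of ker D at its homogeneous elements. *)
Definition ker_loc (d : int) (x : M) := exists u v d1 d2,
  [/\ H d1 u, H d2 v, D u = 0, D v = 0 & [/\ v != 0, d = d1 - d2 & x = j u / j v]].

Let j_eq0 x : (j x == 0) = (x == 0). Proof. exact: tofrac_eq0. Qed.

Lemma ker_loc_sub d x y : ker_loc d x -> ker_loc d y -> ker_loc d (x - y).
Proof.
move=> [u [v [d1 [d2 [Hu Hv Du Dv [vn0 -> ->]]]]]] [u' [v' [d1' [d2' [Hu' Hv' Du' Dv' [vn0' ed ->]]]]]].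
exists (u * v' - u' * v), (v * v'), (d1 + d2'), (d2 + d2'); split.
- apply: (graded_sub grH); first exact: graded_mul.
  have -> : d1 + d2' = d1' + d2.
    by have -> : d1 = d1' - d2' + d2; [rewrite -ed subrK|ring].
  exact: graded_mul.
- exact: graded_mul.
- by rewrite raddfB !(ker_mul DM) // subrr.
- by rewrite (ker_mul DM).
split; [by rewrite mulf_neq0|by ring|].
have -> : j u / j v - j u' / j v' = j u / j v + (- j u') / j v' by rewrite mulNr.
by rewrite addf_div ?j_eq0 // rmorphB !rmorphM mulNr.
Qed.

Lemma ker_loc_mul d d' x y : ker_loc d x -> ker_loc d' y -> ker_loc (d + d') (x * y).
Proof.
move=> [u [v [d1 [d2 [Hu Hv Du Dv [vn0 -> ->]]]]]] [u' [v' [d1' [d2' [Hu' Hv' Du' Dv' [vn0' -> ->]]]]]].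
exists (u * u'), (v * v'), (d1 + d1'), (d2 + d2'); split;
  [exact: graded_mul|exact: graded_mul|by rewrite (ker_mul DM)|by rewrite (ker_mul DM)|].
by split; [rewrite mulf_neq0|ring|rewrite !rmorphM mulf_div].
Qed.

Lemma ker_loc0 d : ker_loc d 0.
Proof.
exists 0, 1, d, 0; split; [exact: graded_zero|exact: graded_one|exact: raddf0|exact: der1|].
by split; [exact: oner_neq0|rewrite subr0|rewrite rmorph0 mul0r].
Qed.

Lemma ker_loc_inv d x : ker_loc d x -> ker_loc (- d) x^-1.
Proof.
have [->|xn0] := eqVneq x 0; first by rewrite invr0 => _; apply: ker_loc0.
move=> [u [v [d1 [d2 [Hu Hv Du Dv [vn0 -> ex]]]]]].
exists v, u, d2, d1; split=> //; split; [|by rewrite opprB|by rewrite ex invf_div].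
by apply: contraNneq xn0 => u0; rewrite ex u0 rmorph0 mul0r.
Qed.

Lemma ker_loc_ker d u : H d u -> D u = 0 -> ker_loc d (j u).
Proof.
move=> Hu Du; exists u, 1, d, 0; split=> //; [exact: graded_one|exact: der1|].
by rewrite oner_neq0 subr0 rmorph1 divr1.
Qed.

Lemma ker_loc_exp d x m : ker_loc d x -> ker_loc (m%:Z * d) (x ^+ m).
Proof.
move=> kx; elim: m => [|m IH].
  by rewrite mul0r expr0 -(rmorph1 j); apply: ker_loc_ker; [exact: graded_one|exact: der1].
by rewrite exprS intS mulrDl mul1r; apply: ker_loc_mul.
Qed.

(** Since Z(A) = Z, z is an integral combination of degrees of nonzero homogeneous kernel elements;
    x is the corresponding product of powers, with inverses for negative coefficients. *)
Lemma ker_loc_degree (z : int) : exists2 x, x != 0 & ker_loc z x.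
Proof.
have [l [Tl ->]] := Dfull z; elim: l Tl => [|[c t] l IH] Tl.
  exists 1; first exact: oner_neq0.
  by rewrite big_nil -(rmorph1 j); apply: ker_loc_ker; [exact: graded_one|exact: der1].
have [x xn0 kx] : exists2 x, x != 0 & ker_loc (\sum_(x <- l) x.1 * x.2) x.
  by apply: IH => y yl; apply: Tl; rewrite inE yl orbT.
have [b [Hb /eqP bn0 Db]] : ker_degree H D t by apply: (Tl (c, t)); rewrite inE eqxx.
have kb := ker_loc_ker Hb Db; have jb : j b != 0 by rewrite j_eq0.
rewrite big_cons /=; case: c {Tl} => m.
  exists (j b ^+ m * x); first by rewrite mulf_neq0 ?expf_neq0.
  by apply: ker_loc_mul => //; apply: ker_loc_exp.
exists ((j b ^+ m.+1)^-1 * x); first by rewrite mulf_neq0 ?invr_eq0 ?expf_neq0.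
apply: ker_loc_mul => //; rewrite NegzE mulNr.
by apply/ker_loc_inv/ker_loc_exp.
Qed.

(* [hfrac x]: x lies in the degree 0 part of the homogeneous localization of B,
   the function field of Proj B. *)
Definition hpair (p q : B) := exists d : nat, [/\ H d p, H d q & q != 0].
Definition hfrac (x : M) := exists p q, hpair p q /\ x = j p / j q.

Lemma hpairD p q p' q' : hpair p q -> hpair p' q' -> hpair (p * q' + p' * q) (q * q').
Proof.
move=> [d [Hp Hq qn]] [d' [Hp' Hq' qn']]; exists (d + d')%N; rewrite PoszD; split.
- by apply: (graded_add grH); [|rewrite addrC]; apply: graded_mul.
- exact: graded_mul.
by rewrite mulf_neq0.
Qed.

Lemma hpairM p q p' q' : hpair p q -> hpair p' q' -> hpair (p * p') (q * q').
Proof.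
move=> [d [Hp Hq qn]] [d' [Hp' Hq' qn']]; exists (d + d')%N; rewrite PoszD; split.
- exact: graded_mul.
- exact: graded_mul.
by rewrite mulf_neq0.
Qed.

Lemma hfracD x y : hfrac x -> hfrac y -> hfrac (x + y).
Proof.
move=> [p [q [pq ->]]] [p' [q' [pq' ->]]].
exists (p * q' + p' * q), (q * q'); split; first exact: hpairD.
have [_ [_ _ qn]] := pq; have [_ [_ _ qn']] := pq'.
by rewrite addf_div ?j_eq0 // rmorphD !rmorphM.
Qed.

Lemma hfracM x y : hfrac x -> hfrac y -> hfrac (x * y).
Proof.
move=> [p [q [pq ->]]] [p' [q' [pq' ->]]].
by exists (p * p'), (q * q'); split; [exact: hpairM|rewrite mulf_div !rmorphM].
Qed.

Lemma hfrac0 : hfrac 0.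
Proof.
exists 0, 1; split; last by rewrite rmorph0 mul0r.
by exists 0%N; split; [exact: graded_zero|exact: graded_one|exact: oner_neq0].
Qed.

Lemma hfracV x : hfrac x -> hfrac x^-1.
Proof.
have [->|xn0] := eqVneq x 0; first by rewrite invr0.
move=> [p [q [[d [Hp Hq qn]] ex]]]; exists q, p; split; last by rewrite ex invf_div.
exists d; split=> //; apply: contraNneq xn0 => p0.
by rewrite ex p0 rmorph0 mul0r.
Qed.

Lemma hfrac_degree (d1 d2 : int) u v : H d1 u -> H d2 v -> d1 = d2 -> v != 0 -> hfrac (j u / j v).
Proof.
move=> Hu Hv ed vn0; have [m em] := Hpos Hv (elimN eqP vn0).
by exists u, v; split=> //; exists m; split=> //; rewrite -em // -ed.
Qed.

(* c rescales the slice to the element t of degree 0. *)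
Variables (K : fieldType) (jK : {rmorphism K -> M}) (c : M).
Hypotheses (cn0 : c != 0) (kc : ker_loc (- ds) c).
Hypothesis SK : forall x, ker_loc 0 x <-> exists y, jK y = x.
Local Notation t := (j s * c).

Definition slice_ev : {poly K} -> M := horner_eval t \o map_poly jK.
HB.instance Definition _ := GRing.RMorphism.on slice_ev.

Lemma slice_evE P : slice_ev P = \sum_(i < size P) jK P`_i * t ^+ i.
Proof.
rewrite /slice_ev /= /horner_eval horner_coef size_map_poly.
by apply: eq_bigr => i _; rewrite coef_map.
Qed.

Lemma slice_evX : slice_ev 'X = t.
Proof. by rewrite /slice_ev /= /horner_eval map_polyX hornerX. Qed.

Lemma slice_evC y : slice_ev y%:P = jK y.
Proof. by rewrite /slice_ev /= /horner_eval map_polyC hornerC. Qed.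

(** A common denominator v in the kernel, built one element at a time. The numerators are gathered
    in a polynomial p so that [ker_poly_horner_inj] can be used. *)
Lemma ker_loc_common_denom (m : nat) (x : nat -> M) :
  (forall i, exists d, ker_loc d (x i)) ->
  exists v (p : {poly B}), [/\ v != 0, D v = 0, ker_poly D p
     & forall i, j p`_i = if (i < m)%N then j v * x i else 0].
Proof.
move=> kx; elim: m => [|m [v [p [vn Dv kp ep]]]].
  exists 1, 0; split; [exact: oner_neq0|exact: der1| |] => i.
    by rewrite coef0 raddf0.
  by rewrite coef0 rmorph0.
have [_ [u [w [_ [_ [_ _ Du Dw [wn _ ex]]]]]]] := kx m.
exists (v * w), (w *: p + (v * u) *: 'X^m); split.
- by rewrite mulf_neq0.
- by rewrite (ker_mul DM).
- move=> i; rewrite coefD !coefZ coefXn raddfD !(ker_mul DM) ?addr0 ?(ker_mul DM) //.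
  exact: (der_nat DM).
move=> i; rewrite coefD !coefZ coefXn rmorphD /= [j (w * _)]rmorphM /= ep ltnS [(i <= m)%N]leq_eqVlt.
have [->|_] /= := eqVneq i m.
  by rewrite ltnn mulr1 mulr0 add0r ex !rmorphM mulrA mulrAC mulfK // j_eq0.
rewrite mulr0 rmorph0 addr0; case: ifP => _; last by rewrite mulr0.
by rewrite rmorphM; ring.
Qed.

(** A relation P(t) = 0 is a relation in s with coefficients P_i c^i in the localized kernel. After
    clearing denominators it contradicts the transcendence of s over the kernel unless P = 0. *)
Lemma slice_ev_inj : injective slice_ev.
Proof.
apply: raddf_inj => P evP.
have ker_c i : exists d, ker_loc d (jK P`_i * c ^+ i).
  exists (0 + i%:Z * - ds); apply: ker_loc_mul; last exact: ker_loc_exp.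
  by apply/SK; exists P`_i.
have [v [p [vn Dv kp ep]]] := ker_loc_common_denom (size P) ker_c.
have sp : (size p <= size P)%N.
  apply/leq_sizeP => i hi; apply/eqP; rewrite -j_eq0 ep ltnNge hi //.
have p0 : p = 0.
  apply: (ker_poly_horner_inj chB DM fn0 kp).
  apply/eqP; rewrite -j_eq0 (horner_coef_wide _ sp) rmorph_sum /=.
  rewrite (eq_bigr (fun i : 'I_(size P) => j v * (jK P`_i * t ^+ i))) => [|i _].
    by rewrite -mulr_sumr -slice_evE evP mulr0.
  by rewrite rmorphM rmorphXn /= ep ltn_ord exprMn; ring.
apply/polyP => i; rewrite coef0; case: (ltnP i (size P)) => [hi|/(nth_default 0) //].
have := ep i; rewrite p0 coef0 rmorph0 hi => /esym/eqP.
rewrite !mulf_eq0 j_eq0 (negPf vn) expf_eq0 (negPf cn0) andbF orbF /=.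
by rewrite fmorph_eq0 => /eqP.
Qed.

Lemma hfrac_slice_ev P : hfrac (slice_ev P).
Proof.
elim/poly_ind: P => [|P y IH]; first by rewrite rmorph0; apply: hfrac0.
rewrite rmorphD rmorphM /= slice_evX slice_evC.
apply: hfracD; first apply: hfracM => //.
  have [u [v [d1 [d2 [Hu Hv Du Dv [vn0 ed ->]]]]]] := kc.
  rewrite mulrA -rmorphM; apply: hfrac_degree (graded_mul grH Hs Hu) Hv _ vn0.
  by rewrite -[ds]opprK ed; ring.
have [u [v [d1 [d2 [Hu Hv Du Dv [vn0 ed ->]]]]]] : ker_loc 0 (jK y) by apply/SK; exists y.
by apply: hfrac_degree Hu Hv _ vn0; apply/eqP; rewrite -subr_eq0 -ed.
Qed.

(** Divide the expansion f^E b = \sum_i p_i s^i by f^E x and write s^i = c^-i t^i. The coefficients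
    p_i / (f^E x c^i) have degree 0, so they come from K. *)
Lemma slice_ev_surj d b x : H d b -> ker_loc d x -> x != 0 ->
  exists P, j b = x * slice_ev P.
Proof.
move=> Hb kx xn0; have [m hm] := Dnil b.
have [E [p [kp Hp ep]]] := slice_expansion grH chB DM DH Dfs Hs hm Hb.
pose f := j (D s) ^+ E.
have fn : f != 0 by rewrite expf_neq0 // j_eq0.
pose y i := j p`_i / f / x * (c ^+ i)^-1.
have ky i : exists z, jK z = y i.
  apply/SK; have -> : 0 = (d + E%:Z * (ds + e) - i%:Z * ds) + - (E%:Z * (ds + e)) + - d
       + - (i%:Z * - ds) by ring.
  apply: ker_loc_mul; last exact/ker_loc_inv/ker_loc_exp.
  apply: ker_loc_mul; last exact/ker_loc_inv.
  apply: ker_loc_mul; first exact: ker_loc_ker.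
  by apply/ker_loc_inv/ker_loc_exp/ker_loc_ker => //; apply: DH.
pose z i := proj1_sig (constructive_indefinite_description _ (ky i)).
have ez i : jK (z i) = y i by rewrite /z; case: constructive_indefinite_description.
exists (\poly_(i < size p) z i).
have ev : slice_ev (\poly_(i < size p) z i) = \sum_(i < size p) y i * t ^+ i.
  rewrite /slice_ev /= /horner_eval poly_def rmorph_sum horner_sum.
  apply: eq_bigr => i _.
  by rewrite /= map_polyZ map_polyXn hornerZ hornerXn ez.
apply: (mulfI fn); rewrite -[LHS]/(j (D s) ^+ E * j b) -rmorphXn -rmorphM ep.
rewrite horner_coef rmorph_sum ev !mulr_sumr; apply: eq_bigr => i _.
rewrite rmorphM rmorphXn /y exprMn /=.
by apply: unscale_term; [exact: fn|exact: xn0|exact: expf_neq0].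
Qed.

Lemma hpair_slice_ev p q : hpair p q ->
  exists P Q, Q != 0 /\ j p / j q = slice_ev P / slice_ev Q.
Proof.
(* The same x of degree d serves for p and q, and cancels in the quotient. *)
move=> [d [Hp Hq qn]]; have [x xn0 kx] := ker_loc_degree d.
have [P eP] := slice_ev_surj Hp kx xn0; have [Q eQ] := slice_ev_surj Hq kx xn0.
exists P, Q; split; last by rewrite eP eQ -mulf_div divff // mul1r.
by apply: contraNneq qn => Q0; rewrite -j_eq0 eQ Q0 rmorph0 mulr0.
Qed.

End Ruled.

Lemma hfrac_ruled (B : idomainType) (H : int -> B -> Prop) (grH : graded H)
    (chB : forall m, (m.+1%:R : B) \is a GRing.unit)
    (Hpos : forall d b, H d b -> b <> 0 -> exists m : nat, d = m)
    (D : {additive B -> B}) (e : int)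
    (DM : forall x y, D (x * y) = x * D y + y * D x)
    (Dnil : forall b, exists m, iter m D b = 0)
    (DH : forall d b, H d b -> H (d + e) (D b))
    (Dfull : forall z, Zgen (ker_degree H D) z)
    (k : fieldType) (h : {rmorphism k -> B})
    (Hh : forall c, H 0 (h c)) (Dh : forall c, D (h c) = 0)
    (d0 : int) (b0 : B) (Hb0 : H d0 b0) (Db0 : D b0 != 0) :
  exists (K : fieldType) (iota : {rmorphism k -> K}) (Phi : B -> B -> {fraction {poly K}}),
  [/\ forall p q p' q', hpair H p q -> hpair H p' q' ->
        (p * q' = p' * q <-> Phi p q = Phi p' q'),
      forall z, exists p q, hpair H p q /\ Phi p q = z,
      forall p q p' q', hpair H p q -> hpair H p' q' ->
        Phi (p * q' + p' * q) (q * q') = Phi p q + Phi p' q',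
      forall p q p' q', hpair H p q -> hpair H p' q' ->
        Phi (p * p') (q * q') = Phi p q * Phi p' q'
    & forall c, Phi (h c) 1 = FracField.tofrac (iota c)%:P].
Proof.
have [ds [s [Hs fn0 Dfs]]] := slice_ex Dnil DH Hb0 Db0.
pose j := @FracField.tofrac B.
have jn0 q : q != 0 -> j q != 0 by rewrite tofrac_eq0.
have [c cn0 kc] := ker_loc_degree grH DM Dfull (- ds).
have [|||c0|K [jK [iota [jiota SK]]]] := @subfield_ex _ (ker_loc H D 0) _ _ _ k (j \o h).
- by rewrite -(rmorph1 j); apply: (ker_loc_ker grH DM); [exact: graded_one|exact: (der1 DM)].
- exact: ker_loc_sub.
- move=> x y kx ky; rewrite -[0]addr0; apply: (ker_loc_mul grH DM) => //.
  by rewrite -[0]oppr0; apply: (ker_loc_inv grH DM).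
- exact: (ker_loc_ker grH DM).
pose ev : {rmorphism {poly K} -> {fraction B}} := slice_ev s jK c.
have ev_inj : injective ev := slice_ev_inj grH chB DM fn0 cn0 kc SK.
(* [Phi p q] is the element of K(t) with value p / q. The choice operator makes it total; [PhiP]
   describes it on homogeneous pairs of equal degree. *)
pose Phi p q := epsilon (inhabits (0 : {fraction {poly K}})) (fun z : {fraction {poly K}} => frac_val ev z (j p / j q)).
have PhiP p q : hpair H p q -> frac_val ev (Phi p q) (j p / j q).
  move=> pq; apply: (epsilon_spec _ (fun z => frac_val ev z (j p / j q))).
  have [P [Q [Qn ->]]] := hpair_slice_ev grH chB DM Dnil DH Dfull Hs fn0 Dfs cn0 kc SK pq.
  by exists (FracField.tofrac P / FracField.tofrac Q), P, Q.
exists K, iota, Phi; split.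
- move=> p q p' q' pq pq'; have [_ [_ _ qn]] := pq; have [_ [_ _ qn']] := pq'.
  have -> : p * q' = p' * q <-> j p / j q = j p' / j q'.
    split=> [e1|/eqP].
      by apply/eqP; rewrite eqr_div ?jn0 // -!rmorphM e1.
    by rewrite eqr_div ?jn0 // -!rmorphM /= tofrac_eq => /eqP.
  split=> e1; last by apply: (frac_val_fun ev_inj (PhiP _ _ pq)); rewrite e1; apply: PhiP.
  by apply: (frac_val_inj ev_inj (PhiP _ _ pq)); rewrite e1; apply: PhiP.
- move=> z; have [P [Q [Qn ez vz]]] := frac_val_ex ev z.
  have hev := hfrac_slice_ev grH Hpos Hs kc SK.
  have [p [q [pq epq]]] : hfrac H (ev P / ev Q) by apply: (hfracM grH (hev P)); apply: (hfracV (hev Q)).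
  exists p, q; split=> //.
  by apply: (frac_val_inj ev_inj (PhiP _ _ pq)); rewrite -[j p / j q]epq.
- move=> p q p' q' pq pq'; have [_ [_ _ qn]] := pq; have [_ [_ _ qn']] := pq'.
  apply: (frac_val_inj ev_inj (PhiP _ _ (hpairD grH pq pq'))).
  have -> : j (p * q' + p' * q) / j (q * q') = j p / j q + j p' / j q'.
    by rewrite addf_div ?jn0 // /j rmorphD !rmorphM.
  by apply: (frac_valD ev_inj); apply: PhiP.
- move=> p q p' q' pq pq'.
  apply: (frac_val_inj ev_inj (PhiP _ _ (hpairM grH pq pq'))).
  have -> : j (p * p') / j (q * q') = (j p / j q) * (j p' / j q').
    by rewrite mulf_div /j !rmorphM.
  by apply: frac_valM; apply: PhiP.
move=> c1; have pq : hpair H (h c1) 1.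
  by exists 0%N; split=> //; [exact: graded_one|exact: oner_neq0].
apply: (frac_val_inj ev_inj (PhiP _ _ pq)).
have -> : j (h c1) / j 1 = ev (iota c1)%:P.
  by rewrite /j rmorph1 divr1 [RHS]slice_evC jiota.
exact: frac_val_tofrac.
Qed.

(** * Homogenization *)

Lemma additive_of (U V : zmodType) (f : U -> V) :
  zmod_morphism f -> exists g : {additive U -> V}, g =1 f.
Proof.
move=> hf; pose m := GRing.isZmodMorphism.Build U V f hf.
pose g : {additive U -> V} := HB.pack f m.
by exists g.
Qed.

Lemma rmorphism_factor (R B S : nzRingType) (pi : {rmorphism R -> B}) (g : {rmorphism R -> S}) :
  (forall b, exists p, pi p = b) -> (forall p, pi p = 0 -> g p = 0) ->
  exists f : {rmorphism B -> S}, forall p, f (pi p) = g p.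
Proof.
move=> surj ker; pose r b := proj1_sig (constructive_indefinite_description _ (surj b)).
have rK b : pi (r b) = b by rewrite /r; case: constructive_indefinite_description.
have gE p q : pi p = pi q -> g p = g q.
  by move=> e; apply/eqP; rewrite -subr_eq0 -rmorphB ker // rmorphB e subrr.
have fB : zmod_morphism (g \o r).
  by move=> x y /=; rewrite -rmorphB; apply: gE; rewrite rmorphB !rK.
have fM : monoid_morphism (g \o r).
  split=> [|x y] /=; first by rewrite -(rmorph1 g); apply: gE; rewrite rK rmorph1.
  by rewrite -rmorphM; apply: gE; rewrite rmorphM !rK.
pose m1 := GRing.isZmodMorphism.Build B S (g \o r) fB.
pose m2 := GRing.isMonoidMorphism.Build B S (g \o r) fM.
pose f : {rmorphism B -> S} := HB.pack (g \o r) m1 m2.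
by exists f => p; apply: gE; rewrite rK.
Qed.

(* A grading of B by N, encoded as the coaction b |-> \sum_d b_d t^d. *)
Section Coaction.
Variables (k : fieldType) (B : idomainType) (h : {rmorphism k -> B}).
Variables (n : nat) (x : 'I_n -> B) (w : 'I_n -> nat).
Variable gam : {rmorphism B -> {poly B}}.
Hypothesis gamx : forall i, gam (x i) = x i *: 'X^(w i).
Hypothesis gamh : forall c, gam (h c) = (h c)%:P.
Hypothesis gen : forall P : B -> Prop, (forall c, P (h c)) -> (forall i, P (x i)) ->
  (forall a b, P a -> P b -> P (a + b)) -> (forall a b, P a -> P b -> P (a * b)) ->
  forall b, P b.

(** The first alternative puts zero also in the negative degrees. *)
Definition ghom (z : int) (b : B) := b = 0 \/ exists2 d : nat, z = d & gam b = b *: 'X^d.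

Lemma gam_horner1 b : (gam b).[1] = b.
Proof.
move: b; apply: gen => [c|i|a b ea eb|a b ea eb].
- by rewrite gamh hornerC.
- by rewrite gamx hornerZ hornerXn expr1n mulr1.
- by rewrite rmorphD hornerD ea eb.
by rewrite rmorphM hornerM ea eb.
Qed.

(** Coassociativity of the coaction. It holds on generators and passes to sums and products. *)
Lemma gam_coef b d : gam (gam b)`_d = (gam b)`_d *: 'X^d.
Proof.
move: b d; apply: gen => [c|i|a b ea eb|a b ea eb] d.
- by rewrite gamh coefC; case: eqP => [->|_]; rewrite ?rmorph0 ?scale0r // gamh expr0 alg_polyC.
- rewrite gamx coefZ coefXn; case: eqP => [->|_].
    by rewrite mulr1 gamx.
  by rewrite mulr0 rmorph0 scale0r.
- by rewrite rmorphD coefD rmorphD scalerDl ea eb.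
rewrite rmorphM coefM rmorph_sum scaler_suml; apply: eq_bigr => i _.
by rewrite rmorphM /= ea eb -scalerAl -scalerAr scalerA -exprD subnKC // -ltnS.
Qed.

Lemma gam_sum b : b = \sum_(d < size (gam b)) (gam b)`_d.
Proof.
rewrite -[LHS]gam_horner1 horner_coef; apply: eq_bigr => i _.
by rewrite expr1n mulr1.
Qed.

Lemma gam_inj b : gam b = 0 -> b = 0.
Proof. by move=> e; rewrite -(gam_horner1 b) e horner0. Qed.

Lemma hom_coef b (d : nat) : ghom d (gam b)`_d.
Proof. by right; exists d; rewrite ?gam_coef. Qed.

Lemma homP (d : nat) b : ghom d b <-> gam b = b *: 'X^d.
Proof.
split=> [[->|[d' [->] //]]|e]; first by rewrite rmorph0 scale0r.
by right; exists d.
Qed.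

Hypothesis chk : forall m, m.+1%:R != 0 :> k.

Lemma natr_unit m : (m.+1%:R : B) \is a GRing.unit.
Proof. by rewrite -(rmorph_nat h) rmorph_unit // unitfE chk. Qed.

Lemma hom_const c : ghom 0 (h c).
Proof. by apply/(homP 0); rewrite gamh expr0 alg_polyC. Qed.

Lemma hom_graded : graded ghom.
Proof.
split.
- move=> d a b [->|[m -> ea]]; last first.
    move=> [->|[m' [<-] eb]]; first by rewrite subr0; right; exists m.
    by right; exists m => //; rewrite rmorphB ea eb scalerBl.
  move=> [->|[m -> eb]]; first by rewrite subr0; left.
  by right; exists m => //; rewrite rmorphB rmorph0 eb !sub0r scaleNr.
- move=> d e a b [->|[m -> ea]]; first by rewrite mul0r; left.
  move=> [->|[m' -> eb]]; first by rewrite mulr0; left.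
  right; exists (m + m')%N => //.
  by rewrite rmorphM /= ea eb -scalerAl -scalerAr scalerA exprD.
- by rewrite -(rmorph1 h); apply: hom_const.
- move=> m; have <- : h (m.+1%:R^-1) = m.+1%:R^-1.
    by rewrite rmorphV ?rmorph_nat // unitfE chk.
  exact: hom_const.
by left.
Qed.

Lemma hom_pos d b : ghom d b -> b <> 0 -> exists m : nat, d = m.
Proof. by move=> [->|[m -> _] _] //; exists m. Qed.

(** * The leading part of a derivation *)

Section Homogenization.
Variable D : {additive B -> B}.
Hypothesis DM : forall a b, D (a * b) = a * D b + b * D a.
Hypothesis Dnil : forall b, exists m, iter m D b = 0.
Hypothesis Dh : forall c, D (h c) = 0.

Let W := (\sum_i w i)%N.
Let wW i : (w i <= W)%N. Proof. by rewrite /W (bigD1 i) //= leq_addr. Qed.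

(* gam (D b), shifted by W so that the degree of the leading part of D is a natural
   number: every D (x i) has components in degree at most w i + N - 1 - W. *)
Let G b : {poly B} := 'X^W * gam (D b).
Let S i : nat := size ('X^(W - w i) * gam (D (x i))).
Let N := (\max_i S i)%N.

Let GD a b : G (a + b) = G a + G b. Proof. by rewrite /G !raddfD mulrDr. Qed.
Let G0 : G 0 = 0. Proof. by rewrite /G !raddf0 mulr0. Qed.
Let Gh c : G (h c) = 0. Proof. by rewrite /G Dh raddf0 mulr0. Qed.
Let Gsum (I : finType) (F : I -> B) : G (\sum_i F i) = \sum_i G (F i).
Proof. by elim/big_rec2: _ => [|i y1 y2 _ <-]; rewrite ?G0 ?GD. Qed.
Let GM d d' a b : gam a = a *: 'X^d -> gam b = b *: 'X^d' ->
  G (a * b) = a *: ('X^d * G b) + b *: ('X^d' * G a).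
Proof.
move=> ea eb; rewrite /G DM rmorphD !rmorphM /= ea eb -!mul_polyC.
by ring.
Qed.

Let size_shift d (p : {poly B}) m : (size p <= m)%N -> (size ('X^d * p)%R <= d + m)%N.
Proof.
have [->|pn0] := eqVneq p 0; first by rewrite mulr0 size_poly0.
by rewrite mulrC size_mulXn // leq_add2l.
Qed.

(** N bounds the shift on the generators, and the Leibniz rule propagates the bound. Stating it for
    every component of b makes it stable under sums and products. *)
Let size_G b d : (size (G (gam b)`_d) <= d + N)%N.
Proof.
move: b d; apply: gen => [c|i|a b ea eb|a b ea eb] d.
- by rewrite gamh coefC; case: ifP => _; rewrite ?Gh ?G0 size_poly0.
- rewrite gamx coefZ coefXn; case: eqP => [->|_]; last by rewrite mulr0 G0 size_poly0.
  rewrite mulr1 /G -(subnKC (wW i)) exprD -mulrA; apply: size_shift.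
  exact: (leq_bigmax (F := S)).
- rewrite rmorphD coefD GD (leq_trans (size_polyD _ _)) // geq_max ea eb //.
rewrite rmorphM coefM Gsum; apply: (leq_trans (size_sum _ _ _)).
apply/bigmax_leqP => i _; have id : (i <= d)%N by rewrite -ltnS.
rewrite (GM (gam_coef _ _) (gam_coef _ _)) (leq_trans (size_polyD _ _)) // geq_max.
apply/andP; split; apply: leq_trans (size_scale_leq _ _) _.
  by rewrite -[X in (_ <= X + N)%N](subnKC id) -addnA; apply: size_shift.
by rewrite -[X in (_ <= X + N)%N](subnK id) -addnA; apply: size_shift.
Qed.

Let size_G_hom b d : gam b = b *: 'X^d -> (size (G b) <= d + N)%N.
Proof.
by move=> e; have := size_G b d; rewrite e coefZ coefXn eqxx mulr1.
Qed.

(** For b homogeneous of degree d, this is the component of D b in the largest degree allowed by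
    [size_G], namely d + N - 1 - W. *)
Definition top (d : nat) b := (G b)`_(d + N.-1).
Definition Dtop b := \sum_(d < size (gam b)) top d (gam b)`_d.

Let topD d a b : top d (a + b) = top d a + top d b.
Proof. by rewrite /top GD coefD. Qed.
Let top0 d : top d 0 = 0. Proof. by rewrite /top G0 coef0. Qed.

Let Dtop_wide b m : (size (gam b) <= m)%N -> Dtop b = \sum_(d < m) top d (gam b)`_d.
Proof.
move=> hm; rewrite /Dtop (big_ord_widen m (fun d => top d (gam b)`_d) hm).
rewrite [RHS](bigID (fun d : 'I_m => (d < size (gam b))%N)) /=.
rewrite [X in _ = _ + X]big1 ?addr0 // => i; rewrite -leqNgt => hi.
by rewrite nth_default // top0.
Qed.

Let DtopD a b : Dtop (a + b) = Dtop a + Dtop b.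
Proof.
pose m := maxn (size (gam (a + b))) (maxn (size (gam a)) (size (gam b))).
rewrite !(@Dtop_wide _ m) ?leq_max ?leqnn ?orbT // -big_split.
by apply: eq_bigr => i _; rewrite rmorphD coefD topD.
Qed.

Let Dtop0 : Dtop 0 = 0.
Proof. by rewrite (@Dtop_wide _ 0) ?big_ord0 // rmorph0 size_poly0. Qed.

Lemma Dtop_hom d b : gam b = b *: 'X^d -> Dtop b = top d b.
Proof.
move=> e; rewrite (@Dtop_wide _ d.+1); last first.
  by rewrite e (leq_trans (size_scale_leq _ _)) // size_polyXn.
rewrite big_ord_recr /= big1 => [|i _]; rewrite e coefZ coefXn.
  by rewrite eqxx mulr1 add0r.
by rewrite ltn_eqF // mulr0 top0.
Qed.

Hypothesis Dn0 : exists b, D b != 0.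

(** Otherwise D would kill the generators, hence all of B. It makes [N.-1] a true predecessor. *)
Let N_gt0 : (0 < N)%N.
Proof.
rewrite lt0n; apply/eqP => N0; have [b] := Dn0; apply/negP; rewrite negbK; apply/eqP.
move: b; apply: gen => [//|i|a b ea eb|a b ea eb].
- apply: gam_inj; have := leq_bigmax (F := S) i.
  rewrite -/N N0 leqn0 size_poly_eq0 mulf_eq0 expf_eq0 polyX_eq0 andbF /=.
  by move/eqP.
- by rewrite raddfD ea eb addr0.
by rewrite DM ea eb !mulr0 addr0.
Qed.

Let size_G_pred b d : gam b = b *: 'X^d -> (size (G b) <= (d + N.-1).+1)%N.
Proof. by rewrite -addnS prednK //; apply: size_G_hom. Qed.

Let topM d d' a b : gam a = a *: 'X^d -> gam b = b *: 'X^d' ->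
  top (d + d') (a * b) = a * top d' b + b * top d a.
Proof.
have e1 : (d + d' + N.-1 < d)%N = false by rewrite ltnNge -addnA leq_addr.
have e2 : (d + d' + N.-1 < d')%N = false by rewrite ltnNge addnAC leq_addl.
have e3 : (d + d' + N.-1 - d = d' + N.-1)%N by rewrite -addnA addKn.
have e4 : (d + d' + N.-1 - d' = d + N.-1)%N by rewrite addnAC addnK.
move=> ea eb; rewrite /top (GM ea eb) coefD !coefZ ![_ * G _]mulrC !coefMXn.
by rewrite e1 e2 e3 e4.
Qed.

Lemma Dtop_mul a b : Dtop (a * b) = a * Dtop b + b * Dtop a.
Proof.
have homM u v d d' : gam u = u *: 'X^d -> gam v = v *: 'X^d' ->
    Dtop (u * v) = u * Dtop v + v * Dtop u.
  move=> eu ev; rewrite (Dtop_hom eu) (Dtop_hom ev) -(topM eu ev).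
  by apply: Dtop_hom; rewrite rmorphM /= eu ev -scalerAl -scalerAr scalerA exprD.
have sumL (I : finType) (F : I -> B) v :
    (forall i, Dtop (F i * v) = F i * Dtop v + v * Dtop (F i)) ->
    Dtop ((\sum_i F i) * v) = (\sum_i F i) * Dtop v + v * Dtop (\sum_i F i).
  move=> hF; elim/big_rec: _ => [|i y _ IH]; first by rewrite !mul0r Dtop0 mulr0 addr0.
  by rewrite mulrDl !DtopD IH hF; ring.
rewrite (gam_sum a); apply: (sumL) => i; rewrite mulrC [RHS]addrC (gam_sum b).
by apply: sumL => i'; apply: homM; apply: gam_coef.
Qed.

(** Components of y of degree below c reach only degrees below c + N - 1 in [G y], so the
    coefficient there sees the component of degree c alone. *)
Let G_bound y c : (size (gam y) <= c.+1)%N ->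
  (size (G y) <= (c + N.-1).+1)%N /\ (G y)`_(c + N.-1) = Dtop (gam y)`_c.
Proof.
move=> sy; have ey : y = \sum_(d < c.+1) (gam y)`_d.
  rewrite {1}(gam_sum y) (big_ord_widen c.+1 (fun d => (gam y)`_d) sy).
  rewrite [RHS](bigID (fun d : 'I_c.+1 => (d < size (gam y))%N)) /=.
  by rewrite [X in _ = _ + X]big1 ?addr0 // => i; rewrite -leqNgt => /(nth_default 0).
rewrite {1 2}ey Gsum; split.
  apply: (leq_trans (size_sum _ _ _)); apply/bigmax_leqP => i _.
  apply: leq_trans (size_G_pred (gam_coef y i)) _.
  by rewrite ltnS leq_add2r -ltnS.
rewrite coef_sum big_ord_recr /= big1 => [|i _].
  by rewrite add0r (Dtop_hom (gam_coef y c)).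
rewrite nth_default // (leq_trans (size_G_pred (gam_coef y i))) //.
by rewrite -addSn leq_add2r.
Qed.

(** If y has degree at most c, then D y has degree at most c + N - 1 - W, and its component there is
    [Dtop] of the component of y in degree c. Induction on m follows y along D. *)
Lemma iter_Dtop m y c : (size (gam y) <= c.+1)%N -> iter m D y = 0 ->
  iter m Dtop (gam y)`_c = 0.
Proof.
elim: m y c => [|m IH] y c sy; first by move=> /= ->; rewrite rmorph0 coef0.
have [sG eG] := G_bound sy; rewrite !iterSr -eG /G mulrC coefMXn => Dy.
(* When c + N - 1 < W the target degree is negative and [Dtop] already gives 0. *)
case: ltnP => [_|hW]; first by elim: (m) => //= m' ->.
apply: IH => //; move: sG; rewrite /G mulrC.
have [->|gn0] := eqVneq (gam (D y)) 0; first by rewrite size_poly0.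
by rewrite size_mulXn // => hs; rewrite -(leq_add2l W) addnS subnKC.
Qed.

Lemma iter_DtopD m a b : iter m Dtop (a + b) = iter m Dtop a + iter m Dtop b.
Proof. by elim: m => //= m ->; rewrite DtopD. Qed.

Lemma Dtop_nil b : exists m, iter m Dtop b = 0.
Proof.
have it0 m : iter m Dtop 0 = 0 by elim: m => //= m ->.
rewrite (gam_sum b); elim/big_rec: _ => [|i y _ [m hm]]; first by exists 0%N.
have [m' hm'] := Dnil (gam b)`_i; exists (m + m')%N.
rewrite iter_DtopD {2}addnC !iterD hm it0 addr0.
rewrite (_ : iter m' _ _ = 0) ?it0 //.
have := @iter_Dtop m' (gam b)`_i i; rewrite gam_coef coefZ coefXn eqxx mulr1; apply => //.
by rewrite (leq_trans (size_scale_leq _ _)) // size_polyXn.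
Qed.

Lemma Dtop_degree d b : ghom d b -> ghom (d + (N.-1%:Z - W%:Z)) (Dtop b).
Proof.
move=> [->|[m -> e]]; first by rewrite Dtop0; left.
rewrite (Dtop_hom e) /top /G mulrC coefMXn; case: ltnP => [_|hW]; first by left.
rewrite addrA -PoszD subzn //; exact: hom_coef.
Qed.

Lemma Dtop_const c : Dtop (h c) = 0.
Proof. by rewrite (@Dtop_hom 0) ?gamh ?expr0 ?alg_polyC // /top Gh coef0. Qed.

(** At a generator that attains the maximum N, the coefficient read by [top] is the leading one. *)
Lemma Dtop_neq0 : exists d b, ghom d b /\ Dtop b != 0.
Proof.
have c0 : (0 < #|'I_n|)%N.
  rewrite lt0n; apply: contraTneq N_gt0 => /card0_eq e0.
  by rewrite /N big1 // => i; have := e0 i; rewrite !inE.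
have [i ei] := bigop.eq_bigmax S c0.
exists (w i), (x i); split; first by right; exists (w i); rewrite ?gamx.
rewrite (Dtop_hom (gamx i)) /top /G -(subnKC (wW i)) exprD -mulrA mulrC coefMXn.
rewrite ltnNge leq_addr /= addKn /N ei -lead_coefE lead_coef_eq0 -size_poly_gt0.
by have := N_gt0; rewrite /N ei.
Qed.

Lemma homogenization : exists (D' : {additive B -> B}) (e : int),
  [/\ forall a b, D' (a * b) = a * D' b + b * D' a,
      forall b, exists m, iter m D' b = 0,
      forall d b, ghom d b -> ghom (d + e) (D' b),
      forall c, D' (h c) = 0
    & exists d b, ghom d b /\ D' b != 0].
Proof.
have [|D' eD] := @additive_of B B Dtop.
  move=> a b; apply/eqP; rewrite eq_sym subr_eq -DtopD subrK //.
exists D', (N.-1%:Z - W%:Z); split.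
- by move=> a b; rewrite !eD Dtop_mul.
- by move=> b; have [m hm] := Dtop_nil b; exists m; rewrite (eq_iter eD).
- by move=> d b /Dtop_degree; rewrite eD.
- by move=> c; rewrite eD Dtop_const.
by have [d [b [Hb nb]]] := Dtop_neq0; exists d, b; rewrite eD.
Qed.

End Homogenization.
End Coaction.

(** * The Pham-Brieskorn ring *)

Lemma mpoly_gen (k : fieldType) (n : nat) (P : {mpoly k[n]} -> Prop) :
  (forall c, P c%:MP) -> (forall i, P 'X_i) ->
  (forall p q, P p -> P q -> P (p + q)) -> (forall p q, P p -> P q -> P (p * q)) ->
  forall p, P p.
Proof.
move=> PC PX PD PM p; rewrite [p]mpolyE; elim/big_ind: _ => //.
  by rewrite -(mpolyC0 n k); apply: PC.
move=> m _; rewrite -mul_mpolyC; apply: (PM) => //; rewrite mpolyXE_id.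
elim/big_ind: _ => // [|i _]; first by rewrite -(mpolyC1 n k); apply: PC.
elim: (m i) => [|d IH]; first by rewrite expr0 -(mpolyC1 n k); apply: PC.
by rewrite exprS; apply: PM.
Qed.

(** * Regularity of pairs of variables modulo [fS] *)

Section Kill.
Variables (k : fieldType) (n : nat) (a : 'I_n -> nat).
Hypothesis a0 : forall i, (0 < a i)%N.
Local Notation R := {mpoly k[n]}.

Definition kill (i : 'I_n) : R -> R :=
  mmap (@mpolyC n k) (fun l => if l == i then 0 else 'X_l).
HB.instance Definition _ i := GRing.RMorphism.on (kill i).

Lemma killX i l : kill i 'X_l = if l == i then 0 else 'X_l.
Proof. by rewrite /kill mmapX mmap1U. Qed.

Lemma kill_mod i p : exists q, p = kill i p + 'X_i * q.
Proof.
move: p; apply: mpoly_gen => [c|l|p q [p' ep] [q' eq]|p q [p' ep] [q' eq]].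
- by exists 0; rewrite /kill mmapC mulr0 addr0.
- rewrite killX; case: eqP => [->|_]; first by exists 1; rewrite mulr1 add0r.
  by exists 0; rewrite mulr0 addr0.
- exists (p' + q'); rewrite [kill i _]rmorphD /= [in LHS]ep [in LHS]eq.
  by ring.
exists (p' * kill i q + kill i p * q' + 'X_i * p' * q').
by rewrite [kill i (p * q)]rmorphM /= [in LHS]ep [in LHS]eq; ring.
Qed.

Lemma kill_terms i (P : pred 'I_n) :
  kill i (other_terms k a P) = other_terms k a [pred l | P l && (l != i)].
Proof.
rewrite /other_terms rmorph_sum /= (bigID (fun l => l != i)) /=.
rewrite [X in _ + X]big1 ?addr0 => [|l /andP[_ /negPn/eqP ->]].
  by apply: eq_bigr => l /andP[_ /negPf nl]; rewrite rmorphXn /= killX nl.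
by rewrite rmorphXn /= killX eqxx expr0n eqn0Ngt a0.
Qed.

Lemma fS_terms : fS k a = other_terms k a predT.
Proof. by []. Qed.

Lemma mpolyX_neq0 i : 'X_i != 0 :> R.
Proof.
apply/eqP => /(congr1 (meval (fun=> 1))); rewrite mevalXU meval0 => /eqP.
by rewrite oner_eq0.
Qed.

Lemma killed_dvd i p : kill i p = 0 -> exists q, p = 'X_i * q.
Proof. by move=> e; have [q ->] := kill_mod i p; exists q; rewrite e add0r. Qed.

Hypothesis n3 : (3 <= n)%N.

Lemma third_index (i j : 'I_n) : exists l, (l != i) && (l != j).
Proof.
have : (0 < #|~: [set i; j]|)%N.
  by rewrite cardsCs setCK card_ord subn_gt0 (leq_ltn_trans _ n3) // cards2; case: (i == j).
by move=> /card_gt0P[l]; rewrite !inE negb_or; exists l.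
Qed.

(** If X_i = r fS, setting X_i = 0 shows that X_i divides r, since the other terms of fS remain.
    Then fS is a unit, although it vanishes at the origin. *)
Lemma mpolyX_notin i : ~ eqB a ('X_i : R) 0.
Proof.
move=> [r]; rewrite subr0 => e.
have := congr1 (kill i) e; rewrite killX eqxx rmorphM /= fS_terms kill_terms => /esym/eqP.
have [l /andP[li _]] := third_index i i.
rewrite mulf_eq0 orbC (negPf (other_terms_neq0 k a0 (i2 := l) _)) //= => /eqP.
move=> /killed_dvd[q er]; have : 'X_i * (q * fS k a) = 'X_i * 1 by rewrite mulr1 mulrA -er.
move=> /(mulfI (mpolyX_neq0 i)) /(congr1 (meval (fun=> 0))).
rewrite mevalM meval1 [meval _ (fS _ _)]raddf_sum /= big1 ?mulr0 => [/eqP|l' _].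
  by rewrite eq_sym oner_eq0.
by rewrite rmorphXn /= mevalXU expr0n eqn0Ngt a0.
Qed.

(** Modulo X_i the relation reads - X_j u = r fS. A third variable keeps fS nonzero modulo X_i and
    X_j, so X_j divides r modulo X_i, and u is a multiple of fS modulo X_i. *)
Lemma mpolyX_regular i j (u v : R) : i != j -> eqB a ('X_i * v) ('X_j * u) ->
  exists w, eqB a u ('X_i * w).
Proof.
move=> ij [r e].
have e1 : - ('X_j * kill i u) = kill i r * kill i (fS k a).
  have := congr1 (kill i) e; rewrite rmorphB !rmorphM /= !killX eqxx mul0r sub0r.
  by rewrite eq_sym (negPf ij).
have [r' er] : exists r', kill i r = 'X_j * r'.
  apply: killed_dvd; have := congr1 (kill j) e1.
  rewrite rmorphN !rmorphM /= killX eqxx mul0r oppr0 fS_terms !kill_terms => /esym/eqP.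
  have [l lij] := third_index i j.
  by rewrite mulf_eq0 orbC (negPf (other_terms_neq0 k a0 (i2 := l) _)) //= => /eqP.
have e2 : kill i u = - r' * kill i (fS k a).
  apply: (mulfI (mpolyX_neq0 j)).
  by rewrite -[LHS]opprK e1 er; ring.
have [q1 eu] := kill_mod i u; have [q2 ef] := kill_mod i (fS k a).
(* Indeed u = - r' (fS - X_i q2) + X_i q1. *)
exists (r' * q2 + q1), (- r').
rewrite [in LHS]eu e2 [X in _ = _ * X]ef; ring.
Qed.

End Kill.

(** * Arithmetic of the weights *)

Section Weights.
Variables (n : nat) (a : 'I_n -> nat).
Hypotheses (n2 : (2 <= n)%N) (a0 : forall i, (0 < a i)%N) (cot : cotype a = 0%N).

Lemma lcmS_gt0 : (0 < lcmS a)%N.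
Proof. by rewrite /lcmS; elim/big_ind: _ => // u v; rewrite lcmn_gt0 => -> ->. Qed.

Lemma dvdn_lcmS i : (a i %| lcmS a)%N.
Proof. by rewrite /lcmS (bigD1 i) //= dvdn_lcml. Qed.

Lemma wtK i : (wt a i * a i = lcmS a)%N.
Proof. by rewrite /wt divnK // dvdn_lcmS. Qed.

Lemma lcmS_dvd_others i : (lcmS a %| \big[lcmn/1%N]_(j < n | j != i) a j)%N.
Proof.
rewrite {1}/lcmS (bigD1 i) //= dvdn_lcm dvdnn andbT.
have /cards0_eq e : #|[set i | ~~ (a i %| \big[lcmn/1%N]_(j < n | j != i) a j)%N]| = 0%N := cot.
by apply/negPn; have := in_set0 i; rewrite -e inE => ->.
Qed.

(** If g divides L / a_j for all j other than i, then g times the lcm of these a_j divides L. Cotype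
    0 makes L divide that lcm, so g = 1. *)
Lemma gcd_wt_others i : \big[gcdn/0%N]_(j < n | j != i) wt a j = 1%N.
Proof.
set g := \big[_/_]_(_ | _) _.
have gw j : j != i -> (a j * g %| lcmS a)%N.
  by move=> ji; rewrite -(wtK j) mulnC dvdn_mul // /g (bigD1 j) //= dvdn_gcdl.
have [j ji] : exists j, j != i.
  have : (0 < #|~: [set i]|)%N by rewrite cardsCs setCK card_ord cards1 subn_gt0.
  by move=> /card_gt0P[j]; rewrite !inE; exists j.
have h : ((\big[lcmn/1%N]_(j < n | j != i) a j) * g %| lcmS a)%N.
  elim/big_ind: _ => [|u v hu hv|l /gw //].
    by rewrite mul1n; apply: dvdn_trans (gw _ ji); apply: dvdn_mull.
  by rewrite muln_lcml dvdn_lcm hu.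
have : (lcmS a * g %| lcmS a * 1)%N.
  by rewrite muln1; apply: dvdn_trans h; rewrite dvdn_mul // lcmS_dvd_others.
by rewrite dvdn_pmul2l ?lcmS_gt0 // dvdn1 => /eqP.
Qed.

Lemma Zgen_wt (T : int -> Prop) i :
  (forall j, j != i -> Zgen T (wt a j)) -> forall z, Zgen T z.
Proof.
move=> hT z; suff h1 : Zgen T 1.
  by rewrite -[z]mulr1 -[z * 1]addr0 -[X in _ + X](mul0r 1); apply: Zgen_lin.
rewrite -[1]/(1%N : int) -(gcd_wt_others i).
elim/big_ind: _ => [|u v hu hv|j /hT //]; first by exists [::]; rewrite big_nil.
have [c [d <-]] : exists c d : int, c * u + d * v = gcdn u v.
  by have [c [d e]] := Bezoutz u v; exists c, d; rewrite e.
exact: Zgen_lin.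
Qed.

End Weights.

(** * From representatives to the quotient ring *)

Section Transfer.
Variables (k : fieldType) (n : nat) (a : 'I_n -> nat).
Hypothesis chk : forall m, m.+1%:R != 0 :> k.
Hypotheses (n3 : (3 <= n)%N) (a0 : forall i, (0 < a i)%N) (cot : cotype a = 0%N).
Local Notation R := {mpoly k[n]}.
Variables (B : idomainType) (pi : {rmorphism R -> B}).
Hypotheses (pi_eq0 : forall p, pi p = 0 <-> eqB a p 0) (pi_surj : forall b, exists p, pi p = b).

Lemma eqB_pi p q : eqB a p q <-> pi p = pi q.
Proof.
have -> : eqB a p q <-> eqB a (p - q) 0 by rewrite /eqB subr0.
rewrite -pi_eq0 rmorphB; split=> [/eqP|->]; last exact: subrr.
by rewrite subr_eq0 => /eqP.
Qed.

Local Notation h := (pi \o @mpolyC n k : {rmorphism k -> B}).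
Let x (i : 'I_n) : B := pi 'X_i.

Lemma pi_gen (P : B -> Prop) : (forall c, P (h c)) -> (forall i, P (x i)) ->
  (forall u v, P u -> P v -> P (u + v)) -> (forall u v, P u -> P v -> P (u * v)) ->
  forall b, P b.
Proof.
move=> Pc Px PD PM b; have [p <-] := pi_surj b; move: p; apply: mpoly_gen => //.
  by move=> p q Pp Pq; rewrite rmorphD; apply: PD.
by move=> p q Pp Pq; rewrite rmorphM; apply: PM.
Qed.

(** The substitution of x_i t^(w_i) for X_i sends [fS] to t^L times its class, which is 0, because
    w_i a_i = L for all i; hence it factors through B. *)
Lemma coaction_ex : exists gam : {rmorphism B -> {poly B}},
  (forall i, gam (x i) = x i *: 'X^(wt a i)) /\ (forall c, gam (h c) = (h c)%:P).
Proof.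
pose g : {rmorphism R -> {poly B}} := mmap (polyC \o h) (fun i => x i *: 'X^(wt a i)).
have gX i : g 'X_i = x i *: 'X^(wt a i) by rewrite /g /= mmapX mmap1U.
have gC c : g c%:MP = (h c)%:P by rewrite /g /= mmapC.
have gf : g (fS k a) = 0.
  have -> : g (fS k a) = pi (fS k a) *: 'X^(lcmS a).
    rewrite /fS !rmorph_sum scaler_suml; apply: eq_bigr => i _.
    by rewrite !rmorphXn gX exprZn -exprM wtK.
  by rewrite (proj2 (pi_eq0 _)) ?scale0r //; exists 1; rewrite subr0 mul1r.
have [p /pi_eq0[r]|gam egam] := rmorphism_factor (g := g) pi_surj.
  by rewrite subr0 => ->; rewrite rmorphM gf mulr0.
by exists gam; split=> [i|c]; rewrite egam ?gX ?gC.
Qed.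

Variable gam : {rmorphism B -> {poly B}}.
Hypotheses (gamx : forall i, gam (x i) = x i *: 'X^(wt a i))
  (gamh : forall c, gam (h c) = (h c)%:P).
Local Notation H := (ghom gam).

Lemma gam_monomial (c : k) m : gam (pi (c *: 'X_[m])) = pi (c *: 'X_[m]) *: 'X^(wdeg a m).
Proof.
rewrite -mul_mpolyC !rmorphM -[pi c%:MP]/(h c) gamh mul_polyC -scalerA; congr (_ *: _).
rewrite mpolyXE_id !rmorph_prod /wdeg; elim/big_rec3: _ => [|i d p q _ IH].
  by rewrite expr0 scale1r.
rewrite IH !rmorphXn gamx exprZn -exprM exprD -scalerAl -scalerAr scalerA.
by [].
Qed.

Lemma homB_hom z p : homB a z p <-> H z (pi p).
Proof.
split.
  move=> [q [/eqB_pi -> hq]]; have [->|qn0] := eqVneq q 0; first by left; rewrite rmorph0.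
  have [d ed] : exists d : nat, z = d.
    by exists (wdeg a (mlead q)); rewrite hq // mlead_supp.
  right; exists d => //; rewrite [q]mpolyE !rmorph_sum scaler_suml !big_seq.
  by apply: eq_bigr => m /hq; rewrite gam_monomial ed => -[->].
move=> [e|[d -> e]].
  exists 0; split; first by apply/eqB_pi; rewrite rmorph0.
  by move=> m; rewrite msupp0.
(* The homogeneous representative is the part of p of weight d, whose class is the degree d
   component of [pi p]. *)
pose q := \sum_(m <- msupp p | wdeg a m == d) p@_m *: 'X_[m] : R.
exists q; split.
  apply/eqB_pi; transitivity (gam (pi p))`_d.
    by rewrite e coefZ coefXn eqxx mulr1.
  rewrite {1}[p]mpolyE /q !rmorph_sum coef_sum [RHS]big_mkcond /=.
  apply: eq_bigr => m _; rewrite gam_monomial coefZ coefXn eq_sym.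
  by case: eqP; rewrite ?mulr1 ?mulr0.
move=> m; rewrite mcoeff_msupp /q raddf_sum /=; have [e'|nd] := eqVneq (wdeg a m) d; first by move=> _; congr Posz.
rewrite big1 ?eqxx // => m' /eqP hm'; rewrite mcoeffZ mcoeffX.
case: (m' =P m) => [em|_]; last by rewrite mulr0.
by rewrite -em hm' eqxx in nd.
Qed.

Lemma x_neq0 i : x i != 0.
Proof. by apply/eqP => /pi_eq0; apply: mpolyX_notin. Qed.

(** D is applied to a chosen representative; its compatibility with [eqB] makes the class of the
    result independent of the choice. *)
Lemma derivB_pi (D : R -> R) : Defs.derivB a D -> exists D' : {additive B -> B},
  [/\ forall p, D' (pi p) = pi (D p),
      forall u v, D' (u * v) = u * D' v + v * D' u & forall c, D' (h c) = 0].
Proof.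
move=> [Deq DD DZ DM].
pose r b := proj1_sig (constructive_indefinite_description _ (pi_surj b)).
have rK b : pi (r b) = b by rewrite /r; case: constructive_indefinite_description.
have eD p : pi (D (r (pi p))) = pi (D p) by apply/eqB_pi/Deq/eqB_pi; rewrite rK.
have [|D' eD'] := @additive_of B B (fun b => pi (D (r b))).
  move=> u v; apply/eqP; rewrite eq_sym subr_eq -rmorphD; apply/eqP/eqB_pi.
  apply/eqB_pi; rewrite -(proj1 (eqB_pi _ _) (DD _ _)); apply/eqB_pi/Deq/eqB_pi.
  by rewrite rmorphD !rK subrK.
have D'pi p : D' (pi p) = pi (D p) by rewrite eD'.
have D'M u v : D' (u * v) = u * D' v + v * D' u.
  rewrite -[u]rK -[v]rK -rmorphM !D'pi (proj1 (eqB_pi _ _) (DM _ _)).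
  by rewrite rmorphD !rmorphM.
exists D'; split=> // c.
have -> : h c = pi (c *: 1) by rewrite /= -mul_mpolyC mulr1.
rewrite D'pi (proj1 (eqB_pi _ _) (DZ _ _)) -mul_mpolyC rmorphM -D'pi rmorph1.
by rewrite (der1 D'M) mulr0.
Qed.

Lemma iter_pi (D : R -> R) (D' : {additive B -> B}) m p :
  (forall p, D' (pi p) = pi (D p)) -> iter m D' (pi p) = pi (iter m D p).
Proof. by move=> eD; elim: m => //= m ->. Qed.

Let natu := natr_unit h chk.
Let gr := hom_graded gamh chk.

Lemma hom_x i : H (wt a i) (x i).
Proof. by right; exists (wt a i). Qed.

(** If Z(A) misses the weight of x_i, then x_i is not in the kernel and, by [regular_pair_degree],
    no other weight is missed. The other weights generate Z. *)
Lemma ker_degree_full (D : {additive B -> B}) (e : int) :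
  (forall u v, D (u * v) = u * D v + v * D u) ->
  (forall b, exists m, iter m D b = 0) ->
  (forall d b, H d b -> H (d + e) (D b)) ->
  forall z, Zgen (ker_degree H D) z.
Proof.
move=> DM Dnil DH; have n0 : (0 < n)%N by apply: leq_trans n3.
have n2 : (2 <= n)%N by apply: leq_trans n3.
have [hw|] := classic (forall j, Zgen (ker_degree H D) (wt a j)).
  exact: (Zgen_wt n2 a0 cot (i := Ordinal n0)).
move=> /not_all_ex_not[i ni]; apply: (Zgen_wt n2 a0 cot (i := i)) => j ji.
apply: NNPP => nj.
have Dx : D (x i) != 0.
  apply/eqP => Dx; apply: ni; apply: Zgen_base; exists (x i).
  by split; [exact: hom_x|exact/eqP/x_neq0|].
apply: (regular_pair_degree gr natu DM Dnil DH (hom_x i) Dx (hom_x i) (hom_x j) (x_neq0 i) _ ni nj).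
move=> u v; have [p <-] := pi_surj u; have [q <-] := pi_surj v.
rewrite -!rmorphM => /eqB_pi; rewrite eq_sym in ji.
move=> /(mpolyX_regular a0 n3 ji) [w ew]; exists (pi w).
by rewrite -rmorphM; apply/eqB_pi.
Qed.

End Transfer.

Unset Implicit Arguments.

Theorem theorem4p4 (k : fieldType) (n : nat) (a : 'I_n -> nat) :
  [pchar k] =i pred0 ->
  (4 <= n)%N ->
  (forall i, (0 < a i)%N) ->
  cotype a = 0%N ->
  (forall D, @HLND k n a D -> forall z : int, Zgen (@kerdeg k n a D) z) /\
  (~ @rigidB k n a -> @ProjB_ruled k n a).
Proof.
move=> /pchar0_natr_neq0 chk n4 a0 cot; have n3 : (3 <= n)%N by apply: leq_trans n4.
have [M [phi phi0]] := fS_residue_field chk n3 a0.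
have [B [pi [pi_phi pi_surj]]] := image_idomain phi.
have pi0 p : pi p = 0 <-> eqB a p 0 by rewrite pi_phi; apply: phi0.
have [gam [gamx gamh]] := coaction_ex pi0 pi_surj.
have gen := pi_gen pi_surj.
have homE := homB_hom pi0 gamx gamh.
have full := ker_degree_full chk n3 a0 cot pi0 pi_surj gamx gamh.
split.
  move=> D [dD nilD [e homD]] z; have [D' [D'pi D'M D'c]] := derivB_pi pi0 pi_surj dD.
  have [b|d b Hb|s [Ts ->]] := full D' e D'M _ _ z.
  - have [p <-] := pi_surj b; have [m /(eqB_pi pi0)] := nilD p.
    by rewrite rmorph0 => em; exists m; rewrite (iter_pi _ _ D'pi).
  - by move: Hb; have [p <-] := pi_surj b; rewrite D'pi => /homE/homD/homE.
  exists s; split=> // u /Ts [b [Hb bn0 Db]]; have [p ep] := pi_surj b.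
  exists p; split; first by apply/homE; rewrite ep.
    by move=> /pi0; rewrite ep.
  by apply/pi0; rewrite -D'pi ep.
move=> nrig.
have [D [[dD nilD] [p0 Dp0]]] : exists D, @LND k n a D /\ exists p, ~ eqB a (D p) 0.
  have [D nD] := not_all_ex_not _ _ nrig; have [lD nD'] := imply_to_and _ _ nD.
  by exists D; split=> //; apply: not_all_ex_not.
have [D' [D'pi D'M D'c]] := derivB_pi pi0 pi_surj dD.
have D'nil b : exists m, iter m D' b = 0.
  have [p <-] := pi_surj b; have [m /(eqB_pi pi0)] := nilD p.
  by rewrite rmorph0 => em; exists m; rewrite (iter_pi _ _ D'pi).
have D'n0 : exists b, D' b != 0.
  by exists (pi p0); rewrite D'pi; apply/eqP => /pi0.
(* D' need not be homogeneous, so its leading part E supplies the kernel and the slice for the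
   ruling. *)
have [E [e [EM Enil EH Ec [d0 [b0 [Hb0 Eb0]]]]]] :=
  homogenization gamx gamh gen D'M D'nil D'c D'n0.
have natu := natr_unit (pi \o @mpolyC n k) chk.
have [K [iota [Phi [P1 P2 P3 P4 P5]]]] := hfrac_ruled (hom_graded gamh chk) natu
  (@hom_pos _ gam) EM Enil EH (full E e EM Enil EH) (hom_const gamh) Ec Hb0 Eb0.
have pairE p q : fracB a p q <-> hpair (ghom gam) (pi p) (pi q).
  split=> [[d [Hp Hq qn]]|[d [Hp Hq qn]]]; exists d; split; try exact/homE.
    by apply/eqP => /pi0.
  by move=> /pi0/eqP; apply/negP.
exists K, iota, (fun p q => Phi (pi p) (pi q)); split.
- move=> p q p' q' /pairE pq /pairE pq'.
  have <- := P1 _ _ _ _ pq pq'; rewrite -!rmorphM; exact: eqB_pi.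
- move=> z; have [u [v [uv <-]]] := P2 z.
  have [p ep] := pi_surj u; have [q eq] := pi_surj v.
  by exists p, q; split; [apply/pairE|]; rewrite ep eq.
- by move=> p q p' q' /pairE pq /pairE pq'; rewrite rmorphD !rmorphM; apply: P3.
- by move=> p q p' q' /pairE pq /pairE pq'; rewrite !rmorphM; apply: P4.
by move=> c; rewrite rmorph1; apply: P5.
Qed.
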